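(* Let $({}_{f_2}M_1\times{}_{f_1}M_2,F)$ be a doubly warped product Finsler manifold. Then its Riemannian curvature $\mathbf{R}^{\ a}_{b\ cd}$ satisfies the following, where $A_{(kl)}\{\cdots\}$ denotes the expression minus the same expression with $k$ and $l$ interchanged: $$\mathbf{R}^{\ i}_{j\ kl}=R^{\ i}_{j\ kl}-A_{(kl)}\Big\{M^r_l\frac{\partial F^i_{jk}}{\partial y^r}+\frac{\delta^dM^i_{jk}}{\delta^dx^l}+F^i_{lh}M^h_{jk}+M^i_{lh}F^h_{jk}-M^i_{lh}M^h_{jk}+\frac{1}{4f_1^2f_2^2}g^{is}g^{\alpha\gamma}\Big(g_{sl}\frac{\partial f_2^2}{\partial u^\gamma}-f_2^2\mathbf{G}^r_\gamma\frac{\partial g_{sl}}{\partial y^r}\Big)\Big(g_{jk}\frac{\partial f_2^2}{\partial u^\alpha}-f_2^2\mathbf{G}^h_\alpha\frac{\partial g_{jk}}{\partial y^h}\Big)\Big\},$$ $$\begin{aligned}\mathbf{R}^{\ i}_{\alpha\ kl}=A_{(kl)}\Big\{&\frac{1}{2f_2^2}\frac{\delta^d}{\delta^dx^l}\Big(\frac{\partial f_2^2}{\partial u^\alpha}\delta^i_k-f_2^2\mathbf{G}^r_\alpha g^{ih}\frac{\partial g_{hk}}{\partial y^r}\Big)+\frac{1}{2f_2^2}(F^i_{rl}-M^i_{rl})\Big(\frac{\partial f_2^2}{\partial u^\alpha}\delta^r_k-f_2^2\mathbf{G}^m_\alpha g^{rh}\frac{\partial g_{hk}}{\partial y^m}\Big)\\&+\frac{1}{4f_1^2f_2^2}\Big(\frac{\partial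 f_2^2}{\partial u^\beta}\delta^i_l-f_2^2\mathbf{G}^r_\beta g^{ih}\frac{\partial g_{hl}}{\partial y^r}\Big)\Big(\frac{\partial f_1^2}{\partial x^k}\delta^\beta_\alpha-f_1^2\mathbf{G}^\mu_kg^{\beta\lambda}\frac{\partial g_{\alpha\lambda}}{\partial v^\mu}\Big)\Big\},\end{aligned}$$ $$\begin{aligned}\mathbf{R}^{\ i}_{j\ \beta\lambda}=A_{(\beta\lambda)}\Big\{&\frac{\delta^d}{\delta^du^\lambda}\Big(\frac{1}{2f_2^2}\Big(\frac{\partial f_2^2}{\partial u^\beta}\delta^i_j-f_2^2\mathbf{G}^r_\beta g^{ih}\frac{\partial g_{hj}}{\partial y^r}\Big)\Big)+\frac{1}{4(f_2^2)^2}\Big(\frac{\partial f_2^2}{\partial u^\lambda}\delta^i_r-f_2^2\mathbf{G}^m_\lambda g^{ih}\frac{\partial g_{hr}}{\partial y^m}\Big)\Big(\frac{\partial f_2^2}{\partial u^\beta}\delta^r_j-f_2^2\mathbf{G}^l_\beta g^{rs}\frac{\partial g_{sj}}{\partial y^l}\Big)\\&-\frac{1}{4f_1^2f_2^2}\Big(\frac{\partial f_1^2}{\partial x^h}g^{ih}g_{\alpha\lambda}-f_1^2\mathbf{G}^\mu_hg^{ih}\frac{\partial g_{\alpha\lambda}}{\partial v^\mu}\Big)\Big(\frac{\partial f_1^2}{\partial x^j}\delta^\alpha_\beta-f_1^2\mathbf{G}^\nu_jg^{\alpha\gamma}\frac{\partial g_{\beta\gamma}}{\partial v^\nu}\Big)\Big\},\end{aligned}$$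 $$\begin{aligned}\mathbf{R}^{\ i}_{\alpha\ \beta l}=&-\frac{\delta^d}{\delta^du^\beta}\Big(\frac{1}{2f_2^2}\Big(\frac{\partial f_2^2}{\partial u^\alpha}\delta^i_l-f_2^2\mathbf{G}^r_\alpha g^{ih}\frac{\partial g_{hl}}{\partial y^r}\Big)\Big)-\frac{1}{2f_2^2}\frac{\delta^d}{\delta^dx^l}\Big(\frac{\partial f_1^2}{\partial x^h}g^{ih}g_{\alpha\beta}-f_1^2\mathbf{G}^\lambda_hg^{ih}\frac{\partial g_{\alpha\beta}}{\partial v^\lambda}\Big)\\&-\frac{1}{4(f_2^2)^2}\Big(\frac{\partial f_2^2}{\partial u^\beta}\delta^i_r-f_2^2\mathbf{G}^m_\beta g^{ih}\frac{\partial g_{hr}}{\partial y^m}\Big)\Big(\frac{\partial f_2^2}{\partial u^\alpha}\delta^r_l-f_2^2\mathbf{G}^s_\alpha g^{rn}\frac{\partial g_{nl}}{\partial y^s}\Big)\\&+\frac{1}{4f_1^2f_2^2}\Big(\frac{\partial f_1^2}{\partial x^h}g^{ih}g_{\mu\beta}-f_1^2\mathbf{G}^\lambda_hg^{ih}\frac{\partial g_{\mu\beta}}{\partial v^\lambda}\Big)\Big(\frac{\partial f_1^2}{\partial x^l}\delta^\mu_\alpha-f_1^2\mathbf{G}^\nu_lg^{\mu\gamma}\frac{\partial g_{\gamma\alpha}}{\partial v^\nu}\Big)\\&-\frac{1}{2f_2^2}g^{rh}(F^i_{rl}-M^i_{rl})\Big(\frac{\partial f_1^2}{\partial x^h}g_{\alpha\beta}-f_1^2\mathbf{G}^\lambda_h\frac{\partial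 g_{\alpha\beta}}{\partial v^\lambda}\Big)+\frac{1}{2f_2^2}\Big(\frac{\partial f_2^2}{\partial u^\mu}\delta^i_l-f_2^2\mathbf{G}^r_\mu g^{ih}\frac{\partial g_{hl}}{\partial y^r}\Big)(F^\mu_{\alpha\beta}-M^\mu_{\alpha\beta}),\end{aligned}$$ $$\begin{aligned}\mathbf{R}^{\ \gamma}_{j\ \beta\lambda}=A_{(\beta\lambda)}\Big\{&\frac{1}{2f_1^2}\frac{\delta^d}{\delta^du^\lambda}\Big(\frac{\partial f_1^2}{\partial x^j}\delta^\gamma_\beta-f_1^2\mathbf{G}^\alpha_jg^{\gamma\mu}\frac{\partial g_{\beta\mu}}{\partial v^\alpha}\Big)+\frac{1}{2f_1^2}(F^\gamma_{\alpha\lambda}-M^\gamma_{\alpha\lambda})\Big(\frac{\partial f_1^2}{\partial x^j}\delta^\alpha_\beta-f_1^2\mathbf{G}^\nu_jg^{\alpha\mu}\frac{\partial g_{\beta\mu}}{\partial v^\nu}\Big)\\&+\frac{1}{4f_1^2f_2^2}\Big(\frac{\partial f_1^2}{\partial x^r}\delta^\gamma_\lambda-f_1^2\mathbf{G}^\alpha_rg^{\gamma\mu}\frac{\partial g_{\lambda\mu}}{\partial v^\alpha}\Big)\Big(\frac{\partial f_2^2}{\partial u^\beta}\delta^r_j-f_2^2\mathbf{G}^m_\beta g^{rh}\frac{\partial g_{hj}}{\partial y^m}\Big)\Big\},\end{aligned}$$ $$\begin{aligned}\mathbf{R}^{\ \gamma}_{\alpha\ kl}=A_{(kl)}\Big\{&\frac{\delta^d}{\delta^dx^l}\Big(\frac{1}{2f_1^2}\Big(\frac{\partial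 f_1^2}{\partial x^k}\delta^\gamma_\alpha-f_1^2\mathbf{G}^\mu_kg^{\gamma\lambda}\frac{\partial g_{\alpha\lambda}}{\partial v^\mu}\Big)\Big)+\frac{1}{4(f_1^2)^2}\Big(\frac{\partial f_1^2}{\partial x^l}\delta^\gamma_\beta-f_1^2\mathbf{G}^\kappa_lg^{\gamma\lambda}\frac{\partial g_{\beta\lambda}}{\partial v^\kappa}\Big)\Big(\frac{\partial f_1^2}{\partial x^k}\delta^\beta_\alpha-f_1^2\mathbf{G}^\nu_kg^{\beta\mu}\frac{\partial g_{\alpha\mu}}{\partial v^\nu}\Big)\\&-\frac{1}{4f_1^2f_2^2}g^{\gamma\lambda}\Big(\frac{\partial f_2^2}{\partial u^\lambda}g_{lr}-f_2^2\mathbf{G}^m_\lambda\frac{\partial g_{lr}}{\partial y^m}\Big)\Big(\frac{\partial f_2^2}{\partial u^\alpha}\delta^r_k-f_2^2\mathbf{G}^s_\alpha g^{rh}\frac{\partial g_{hk}}{\partial y^s}\Big)\Big\},\end{aligned}$$ $$\begin{aligned}\mathbf{R}^{\ \gamma}_{\alpha\ \beta\lambda}=R^{\ \gamma}_{\alpha\ \beta\lambda}-A_{(\beta\lambda)}\Big\{&M^\kappa_\lambda\frac{\partial F^\gamma_{\alpha\beta}}{\partial v^\kappa}+\frac{\delta^dM^\gamma_{\alpha\beta}}{\delta^du^\lambda}+F^\gamma_{\lambda\mu}M^\mu_{\alpha\beta}+M^\gamma_{\lambda\mu}(F^\mu_{\alpha\beta}-M^\mu_{\alpha\beta})\\&+\frac{1}{4f_1^2f_2^2}g^{\gamma\nu}g^{rs}\Big(g_{\nu\lambda}\frac{\partial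 f_1^2}{\partial x^s}-f_1^2\mathbf{G}^\kappa_s\frac{\partial g_{\nu\lambda}}{\partial v^\kappa}\Big)\Big(g_{\alpha\beta}\frac{\partial f_1^2}{\partial x^r}-f_1^2\mathbf{G}^\mu_r\frac{\partial g_{\alpha\beta}}{\partial v^\mu}\Big)\Big\}.\end{aligned}$$
   Context: A Finsler metric on a manifold $M$ is a function $F:TM\to[0,\infty)$ that is $C^\infty$ on the slit tangent bundle $TM^\circ$, positively $1$-homogeneous on fibres, and whose fibre Hessian of $\frac12F^2$ is positive definite. Let $(M_1,F_1)$, $(M_2,F_2)$ be Finsler manifolds of dimensions $n_1,n_2$ and let $f_1:M_1\to\mathbb{R}^+$, $f_2:M_2\to\mathbb{R}^+$ be smooth. The doubly warped product Finsler manifold $({}_{f_2}M_1\times{}_{f_1}M_2,F)$ is $M=M_1\times M_2$ with $$F(v_1,v_2)=\sqrt{f_2^2(\pi_2(v_2))F_1^2(v_1)+f_1^2(\pi_1(v_1))F_2^2(v_2)},\qquad (v_1,v_2)\in TM^\circ:=TM_1^\circ\times TM_2^\circ,$$ where $\pi_1,\pi_2$ are the base-point projections; all objects are considered on $TM^\circ$. Local induced coordinates are $(x^i,y^i)$ on $TM_1$, $(u^\alpha,v^\alpha)$ on $TM_2$, and $\mathbf{x}^a=(x^i,u^\alpha)$, $\mathbf{y}^a=(y^i,v^\alpha)$ on $TM$; Latin indices $i,j,h,k,l,m,n,r,s$ belong to $M_1$, Greek indices to $M_2$, and $a,b,c,d,e$ run over all $n_1+n_2$ values; repeated indices are summed.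 $g_{ij}=\frac12\frac{\partial^2F_1^2}{\partial y^i\partial y^j}$, $g_{\alpha\beta}=\frac12\frac{\partial^2F_2^2}{\partial v^\alpha\partial v^\beta}$, $\mathbf{g}_{ab}=\frac12\frac{\partial^2F^2}{\partial\mathbf{y}^a\partial\mathbf{y}^b}$ (so $\mathbf{g}_{ij}=f_2^2g_{ij}$, $\mathbf{g}_{\alpha\beta}=f_1^2g_{\alpha\beta}$, $\mathbf{g}_{i\beta}=0$), with inverses denoted by upper indices. Product objects (boldface): $\mathbf{G}^a=\frac14\mathbf{g}^{ab}\big(\frac{\partial^2F^2}{\partial\mathbf{y}^b\partial\mathbf{x}^c}\mathbf{y}^c-\frac{\partial F^2}{\partial\mathbf{x}^b}\big)$, $\mathbf{G}^a_b=\frac{\partial\mathbf{G}^a}{\partial\mathbf{y}^b}$, $\frac{\delta^d}{\delta^d\mathbf{x}^a}=\frac{\partial}{\partial\mathbf{x}^a}-\mathbf{G}^b_a\frac{\partial}{\partial\mathbf{y}^b}$ (with components $\frac{\delta^d}{\delta^dx^i}$, $\frac{\delta^d}{\delta^du^\alpha}$; the superscript $d$ in $\delta^d$ is a label, not an index), $$\mathbf{F}^c_{ab}=\tfrac12\mathbf{g}^{ce}\Big(\frac{\delta^d\mathbf{g}_{ea}}{\delta^d\mathbf{x}^b}+\frac{\delta^d\mathbf{g}_{eb}}{\delta^d\mathbf{x}^a}-\frac{\delta^d\mathbf{g}_{ab}}{\delta^d\mathbf{x}^e}\Big),\qquad \mathbf{R}^{\ a}_{b\ cd}=\frac{\delta^d\mathbf{F}^a_{bc}}{\delta^d\mathbf{x}^d}-\frac{\delta^d\mathbf{F}^a_{bd}}{\delta^d\mathbf{x}^c}+\mathbf{F}^a_{de}\mathbf{F}^e_{bc}-\mathbf{F}^a_{ce}\mathbf{F}^e_{bd}.$$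 Component objects (not bold): $F^k_{ij}$, $R^{\ i}_{j\ kl}$ on $M_1$ and $F^\gamma_{\alpha\beta}$, $R^{\ \gamma}_{\alpha\ \beta\lambda}$ on $M_2$ are defined by the same formulas from $F_1$ and from $F_2$, using $\frac{\delta}{\delta x^i}=\frac{\partial}{\partial x^i}-G^j_i\frac{\partial}{\partial y^j}$ and $\frac{\delta}{\delta u^\alpha}=\frac{\partial}{\partial u^\alpha}-G^\beta_\alpha\frac{\partial}{\partial v^\beta}$, where $G^j_i=\frac{\partial G^j}{\partial y^i}$, $G^\beta_\alpha=\frac{\partial G^\beta}{\partial v^\alpha}$ come from the spray coefficients of $F_1$, $F_2$. Finally $$M^r_i=\frac{1}{2f_2^2}\frac{\partial f_2^2}{\partial u^\alpha}v^\alpha\delta^r_i-\frac{1}{4f_2^2}\frac{\partial g^{rh}}{\partial y^i}\frac{\partial f_1^2}{\partial x^h}F_2^2,\qquad M^\mu_\alpha=\frac{1}{2f_1^2}\frac{\partial f_1^2}{\partial x^r}y^r\delta^\mu_\alpha-\frac{1}{4f_1^2}\frac{\partial g^{\mu\lambda}}{\partial v^\alpha}\frac{\partial f_2^2}{\partial u^\lambda}F_1^2,$$ $$M^i_{jk}=\tfrac12g^{ih}\Big(M^r_k\frac{\partial g_{hj}}{\partial y^r}+M^r_j\frac{\partial g_{hk}}{\partial y^r}-M^r_h\frac{\partial g_{jk}}{\partial y^r}\Big),\qquad M^\gamma_{\alpha\beta}=\tfrac12g^{\gamma\nu}\Big(M^\mu_\beta\frac{\partial g_{\nu\alpha}}{\partial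 v^\mu}+M^\mu_\alpha\frac{\partial g_{\nu\beta}}{\partial v^\mu}-M^\mu_\nu\frac{\partial g_{\alpha\beta}}{\partial v^\mu}\Big).$$ *)

(* Defs.v *)
From mathcomp Require Import all_boot all_order all_algebra.
From mathcomp Require Import all_classical all_reals all_analysis.

Set Implicit Arguments.
Unset Strict Implicit.
Unset Printing Implicit Defensive.

Import Order.TTheory GRing.Theory Num.Theory.
Import numFieldNormedType.Exports.

Local Open Scope classical_set_scope.
Local Open Scope ring_scope.

Section Smooth.
Context {R : realType} {V W : normedModType R}.
Implicit Types (A : set V) (f g : V -> W).

Definition iter_derive (s : seq V) f : V -> W :=
  foldl (fun h v => 'D_v h) f s.

(* C^oo on the open set A: every iterated directional derivative is
   differentiable, hence continuous, at every point of A. *)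
Definition smooth_on A f :=
  forall (s : seq V) (x : V), A x -> differentiable (iter_derive s f) x.

Lemma smooth_on_derive A f v : smooth_on A f -> smooth_on A ('D_v f).
Proof. by move=> sf s; exact: (sf (v :: s)). Qed.

Lemma near_eq_differentiable f g (x : V) :
  (\forall y \near x, f y = g y) -> differentiable f x -> differentiable g x.
Proof.
move=> fg df; apply/diff_locallyP.
have gE : g \o shift x = cst (g x) + 'd f x +o_ 0 id.
  have [_ /eqaddoP fo] := (diff_locallyP _ _).1 df.
  apply/eqaddoP => e e0; have := fo e e0.
  have : \forall h \near 0, f (h + x) = g (h + x).
    by move: fg; rewrite (near_shift 0) /=; apply: filterS => h; rewrite /= subr0.
  apply: filterS2 => h E /=.
  by rewrite !fctE /= E (nbhs_singleton fg).
have dc : continuous ('d f x) by case: df => [[]].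
by rewrite (diff_unique dc gE).
Qed.

Lemma eq_iter_derive A f g s : open A -> {in A, f =1 g} ->
  {in A, iter_derive s f =1 iter_derive s g}.
Proof.
move=> oA; elim: s f g => [//|v s IH] f g fg; apply: IH => y /set_mem Ay.
apply: near_eq_derive; apply: filterS (open_nbhs_nbhs (conj oA Ay)) => z Az.
by apply: fg; exact: mem_set.
Qed.

Lemma eq_differentiable_iter A f g s x : open A -> {in A, f =1 g} -> A x ->
  differentiable (iter_derive s f) x -> differentiable (iter_derive s g) x.
Proof.
move=> oA fg Ax; apply: near_eq_differentiable.
apply: filterS (open_nbhs_nbhs (conj oA Ax)) => z Az.
by apply: (eq_iter_derive _ oA fg); exact: mem_set.
Qed.

Lemma differentiable_iterD A f g s : open A ->
  (forall t x, (size t <= size s)%N -> A x ->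
     differentiable (iter_derive t f) x) ->
  (forall t x, (size t <= size s)%N -> A x ->
     differentiable (iter_derive t g) x) ->
  forall x, A x -> differentiable (iter_derive s (f + g)) x.
Proof.
move=> oA; elim: s f g => [|v s IH] f g sf sg x Ax.
  by apply: differentiableD; [exact: (sf [::])|exact: (sg [::])].
apply: (@eq_differentiable_iter A ('D_v f + 'D_v g) _ s) => //; last first.
  apply: IH => // t y ts Ay; [exact: (sf (v :: t))|exact: (sg (v :: t))].
move=> y /set_mem Ay; rewrite deriveD //; apply: diff_derivable.
  exact: (sf [::]).
exact: (sg [::]).
Qed.

Lemma smooth_onD A f g : open A ->
  smooth_on A f -> smooth_on A g -> smooth_on A (f + g).
Proof.
by move=> oA sf sg s; apply: differentiable_iterD => // t x _; [exact: sf|exact: sg].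
Qed.

Lemma smooth_onZ A f (c : R) : open A -> smooth_on A f -> smooth_on A (c *: f).
Proof.
move=> oA sf s; elim: s f sf => [|v s IH] f sf x Ax.
  by apply: differentiableZ; exact: (sf [::]).
apply: (@eq_differentiable_iter A (c *: 'D_v f) _ s) => //; last first.
  by apply: IH => //; exact: smooth_on_derive.
move=> y /set_mem Ay; rewrite deriveZ //; apply: diff_derivable.
exact: (sf [::]).
Qed.
End Smooth.

Lemma smooth_onM (R : realType) (V : normedModType R) (A : set V)
    (f g : V -> R) : open A ->
  smooth_on A f -> smooth_on A g -> smooth_on A (f * g).
Proof.
move=> oA sf sg s.
have [k] := ubnP (size s); elim: k => // k IH in s f g sf sg *.
case: s => [_ x Ax|v s /= sk x Ax].
  by apply: differentiableM; [exact: (sf [::])|exact: (sg [::])].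
apply: (@eq_differentiable_iter _ _ _ A (f * 'D_v g + g * 'D_v f) _ s) => //.
  move=> y /set_mem Ay; rewrite deriveM //; apply: diff_derivable.
    exact: (sf [::]).
  exact: (sg [::]).
apply: (@differentiable_iterD _ _ _ A) => // t y ts Ay; apply: IH => //.
- exact: smooth_on_derive.
- exact: leq_ltn_trans ts sk.
- exact: smooth_on_derive.
- exact: leq_ltn_trans ts sk.
Qed.

Section Manifold.
Context {R : realType}.

Record chart (n : nat) (M : topologicalType) := Chart {
  chart_dom : set M;
  chart_map :> M -> 'rV[R]_n;
  chart_inv : 'rV[R]_n -> M;
  chart_dom_open : open chart_dom;
  chart_img_open : open (chart_map @` chart_dom);
  chart_mapK : forall p, chart_dom p -> chart_inv (chart_map p) = p;
  chart_map_cont : {within chart_dom, continuous chart_map};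
  chart_inv_cont : {within chart_map @` chart_dom, continuous chart_inv} }.

Definition chart_img n (M : topologicalType) (c : chart n M) : set 'rV[R]_n :=
  c @` chart_dom c.

Definition smooth_transition n (M : topologicalType) (c c' : chart n M) :=
  smooth_on (c @` (chart_dom c `&` chart_dom c')) (c' \o chart_inv c).

(* A smooth n-manifold: Hausdorff, second countable, with a maximal
   C^oo atlas. *)
Record manifold (n : nat) := Manifold {
  manifold_space :> topologicalType;
  atlas : set (chart n manifold_space);
  manifold_hausdorff : hausdorff_space manifold_space;
  manifold_second_countable : @second_countable manifold_space;
  atlas_cover : forall p, exists2 c, atlas c & chart_dom c p;
  atlas_compatible : forall c c', atlas c -> atlas c' -> smooth_transition c c';
  atlas_maximal : forall c,
    (forall c', atlas c' -> smooth_transition c c' /\ smooth_transition c' c) ->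
    atlas c }.

Section Tangent.
Context {n : nat} (M : manifold n).

Definition smooth_fun (f : M -> R) :=
  forall c, atlas c -> smooth_on (chart_img c) (f \o chart_inv c).

Lemma smooth_funD f g : smooth_fun f -> smooth_fun g -> smooth_fun (f + g).
Proof.
move=> sf sg c ac; apply: smooth_onD; [exact: chart_img_open|exact: sf|exact: sg].
Qed.

Lemma smooth_funZ (a : R) f : smooth_fun f -> smooth_fun (a *: f).
Proof. move=> sf c ac; apply: smooth_onZ; [exact: chart_img_open|exact: sf]. Qed.

Lemma smooth_funM f g : smooth_fun f -> smooth_fun g -> smooth_fun (f * g).
Proof.
move=> sf sg c ac; apply: smooth_onM; [exact: chart_img_open|exact: sf|exact: sg].
Qed.

(* A point of TM: a base point with a derivation of C^oo(M) at that point.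
   The derivation is a total operator set to 0 outside C^oo(M), so that
   tangent vectors with the same action on C^oo(M) are equal. *)
Record tangent := Tangent {
  tbase : M;
  tact :> (M -> R) -> R;
  tactD : forall f g, smooth_fun f -> smooth_fun g ->
    tact (f + g) = tact f + tact g;
  tactZ : forall a f, smooth_fun f -> tact (a *: f) = a * tact f;
  tactM : forall f g, smooth_fun f -> smooth_fun g ->
    tact (f * g) = f tbase * tact g + g tbase * tact f;
  tact_out : forall f, ~ smooth_fun f -> tact f = 0 }.

Section Scale.
Variables (a : R) (X : tangent).

Let act (f : M -> R) := a * X f.

Let actD f g : smooth_fun f -> smooth_fun g -> act (f + g) = act f + act g.
Proof. by move=> sf sg; rewrite /act tactD // mulrDr. Qed.

Let actZ b f : smooth_fun f -> act (b *: f) = b * act f.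
Proof. by move=> sf; rewrite /act tactZ // mulrCA. Qed.

Let actM f g : smooth_fun f -> smooth_fun g ->
  act (f * g) = f (tbase X) * act g + g (tbase X) * act f.
Proof. by move=> sf sg; rewrite /act tactM // mulrDr !(mulrCA a). Qed.

Let act_out f : ~ smooth_fun f -> act f = 0.
Proof. by move=> nf; rewrite /act tact_out // mulr0. Qed.

Definition tscale : tangent := Tangent actD actZ actM act_out.
End Scale.

Section Coordinate.
Variables (c : chart n M) (x y : 'rV[R]_n).

Let act (f : M -> R) : R :=
  if `[< atlas c /\ chart_img c x /\ smooth_fun f >]
  then 'D_y (f \o chart_inv c) x else 0.

Let dif f : atlas c -> chart_img c x -> smooth_fun f ->
  derivable (f \o chart_inv c) x y.
Proof.
by move=> ac cx sf; apply: diff_derivable; exact: (sf c ac [::] x cx).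
Qed.

Let actE f : atlas c -> chart_img c x -> smooth_fun f ->
  act f = 'D_y (f \o chart_inv c) x.
Proof. by move=> ac cx sf; rewrite /act; case: asboolP => // -[]. Qed.

Let act0 f : ~ (atlas c /\ chart_img c x) -> act f = 0.
Proof. by move=> h; rewrite /act; case: asboolP => // -[ac [cx _]]; case: h. Qed.

Let actD f g : smooth_fun f -> smooth_fun g -> act (f + g) = act f + act g.
Proof.
move=> sf sg; have [[ac cx]|h] := pselect (atlas c /\ chart_img c x).
  rewrite !actE //; last exact: smooth_funD.
  by rewrite -deriveD //; exact: dif.
by rewrite !act0 // addr0.
Qed.

Let actZ a f : smooth_fun f -> act (a *: f) = a * act f.
Proof.
move=> sf; have [[ac cx]|h] := pselect (atlas c /\ chart_img c x).
  rewrite !actE //; last exact: smooth_funZ.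
  by rewrite -[RHS]/(a *: _) -deriveZ //; exact: dif.
by rewrite !act0 // mulr0.
Qed.

Let actM f g : smooth_fun f -> smooth_fun g ->
  act (f * g) = f (chart_inv c x) * act g + g (chart_inv c x) * act f.
Proof.
move=> sf sg; have [[ac cx]|h] := pselect (atlas c /\ chart_img c x).
  rewrite !actE //; last exact: smooth_funM.
  by rewrite -[RHS]deriveM //; exact: dif.
by rewrite !act0 // !mulr0 addr0.
Qed.

Let act_out f : ~ smooth_fun f -> act f = 0.
Proof. by move=> h; rewrite /act; case: asboolP => // -[_ []]. Qed.

(* The tangent vector y^i d/dx^i at the point of coordinates x in the
   chart c (a junk value when c is not in the atlas or x is not in its
   image). *)
Definition tcoord : tangent := Tangent actD actZ actM act_out.
End Coordinate.
End Tangent.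
End Manifold.

Arguments chart : clear implicits.
Arguments manifold : clear implicits.

(* Pairs (x, y) of coordinates of a base point and of a tangent vector. *)
Notation phase R n := ('rV[R]_n * 'rV[R]_n)%type.

(* Finsler geometry in local induced coordinates; L stands for the square of
   the metric, as a function of (x, y). *)
Section LocalFinsler.
Context {R : realType} {n : nat}.
Implicit Types (h L : phase R n -> R) (z : phase R n).

Definition dpos (i : 'I_n) h z : R := 'D_(delta_mx 0 i, 0) h z.
Definition dvel (i : 'I_n) h z : R := 'D_(0, delta_mx 0 i) h z.

Definition gmx L z : 'M[R]_n := \matrix_(i, j) (2^-1 * dvel i (dvel j L) z).
Definition glow L i j z : R := gmx L z i j.
Definition gup L i j z : R := invmx (gmx L z) i j.

Definition spray L (i : 'I_n) z : R :=
  4^-1 * \sum_j gup L i j z *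
    (\sum_k dvel j (dpos k L) z * z.2 0 k - dpos j L z).

(* nonlin L i j = dG^i/dy^j *)
Definition nonlin L (i j : 'I_n) z : R := dvel j (spray L i) z.

Definition hdelta L (i : 'I_n) h z : R :=
  dpos i h z - \sum_j nonlin L j i z * dvel j h z.

(* conn L k i j = F^k_ij *)
Definition conn L (k i j : 'I_n) z : R :=
  2^-1 * \sum_e gup L k e z *
    (hdelta L j (glow L e i) z + hdelta L i (glow L e j) z
     - hdelta L e (glow L i j) z).

(* riem L b a c d = R_b^a_cd *)
Definition riem L (b a c d : 'I_n) z : R :=
  hdelta L d (conn L a b c) z - hdelta L c (conn L a b d) z
  + \sum_e conn L a d e z * conn L e b c z
  - \sum_e conn L a c e z * conn L e b d z.
End LocalFinsler.

Section Finsler.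
Context {R : realType} {n : nat} {M : manifold R n}.

Definition in_coord (c : chart R n M) (F : tangent M -> R) (z : phase R n) : R :=
  F (tcoord c z.1 z.2).

Definition slit (c : chart R n M) : set (phase R n) :=
  [set z | chart_img c z.1 /\ z.2 != 0].
End Finsler.

Record finsler (R : realType) (n : nat) (M : manifold R n) := Finsler {
  fnorm :> tangent M -> R;
  fnorm_ge0 : forall X, 0 <= fnorm X;
  fnorm_smooth : forall c, atlas c -> smooth_on (slit c) (in_coord c fnorm);
  fnorm_homogeneous : forall (a : R) X, 0 < a ->
    fnorm (tscale a X) = a * fnorm X;
  fnorm_convex : forall c z (w : 'rV[R]_n), atlas c -> slit c z -> w != 0 ->
    0 < \sum_i \sum_j
          glow (fun z => in_coord c fnorm z ^+ 2) i j z * w 0 i * w 0 j }.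

(* TM is identified with TM_1 x TM_2. *)
Definition dwp_norm (R : realType) (n1 n2 : nat)
    (M1 : manifold R n1) (M2 : manifold R n2)
    (F1 : finsler M1) (F2 : finsler M2) (f1 : M1 -> R) (f2 : M2 -> R)
    (X : tangent M1 * tangent M2) : R :=
  Num.sqrt (f2 (tbase X.2) ^+ 2 * F1 X.1 ^+ 2 + f1 (tbase X.1) ^+ 2 * F2 X.2 ^+ 2).

(* A point of phase R (n1 + n2) has coordinates ((x, u), (y, v)); the two
   projections return (x, y) and (u, v). *)
Definition phase1 (R : realType) (n1 n2 : nat) (z : phase R (n1 + n2)) :
  phase R n1 := (lsubmx z.1, lsubmx z.2).
Definition phase2 (R : realType) (n1 n2 : nat) (z : phase R (n1 + n2)) :
  phase R n2 := (rsubmx z.1, rsubmx z.2).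

Definition alternate (R : realType) (n : nat) (E : 'I_n -> 'I_n -> R)
  (k l : 'I_n) : R := E k l - E l k.

(* Main.v *)
Require Import Defs.
From HB Require Import structures.
From mathcomp Require Import all_boot all_order all_algebra.
From mathcomp Require Import all_classical all_reals all_analysis.
From mathcomp Require Import ring.

(* In the splitting of the coordinates, g is block diagonal with blocks
   f_2^2 g_ij and f_1^2 g_ab, hence so is its inverse, and Euler's relation
   turns the spray of the product into G^i plus terms whose y-derivative is
   M^r_i: the nonlinear connection restricted to a factor is G^r_i + M^r_i.
   Therefore F^i_jk of the product is F^i_jk - M^i_jk, and the coefficients
   with mixed indices are contractions of delta^d g_jk / delta^d u^a and of
   delta^d g_ab / delta^d x^i.  Substituting in the definition of the curvature
   and splitting each contracted index gives the formulas; the warping function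
   f_2 passes through delta^d / delta^d x^i since it depends on u alone.
   Symmetry of g (equality of mixed derivatives) is used throughout, and
   exchanging the two factors halves the work. *)

Set Implicit Arguments.
Unset Strict Implicit.
Unset Printing Implicit Defensive.

Import Order.TTheory GRing.Theory Num.Theory.
Import numFieldNormedType.Exports.
Local Open Scope classical_set_scope.
Local Open Scope ring_scope.

(** * Smooth functions on an open set *)

(** The squared metrics are known to be smooth only where both y and v are nonzero, so every
    identity below lives on an open phase domain and is differentiated only through openness. Before
    a rule of calculus touches an entry of g^{-1}, a spray or a connection coefficient, smoothness
    there must be available; the curvature involves four derivatives of F^2, so it is carried to all
    orders. The mixed coefficients G^r_a of the nonlinear connection are never computed. They enter
    only through the horizontal derivative of f_2^2 g_jk along u^a, that is g_jk df_2^2/du^a - f_2^2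
    G^r_a dg_jk/dy^r, and the statement keeps them in this form. Since the mixed block of the metric
    vanishes identically, just one of the three derivatives in a mixed connection coefficient
    survives, with constant 1/(2 f_2^2) or 1/(2 f_1^2). It is the subtracted one when the two lower
    indices belong to the factor opposite to the upper index, hence the minus signs. The constants
    1/(4 f_1^2 f_2^2) and 1/(4 (f_2^2)^2) are products of two of these. *)

Section SmoothCalculus.
Context {R : realType} {V : normedModType R}.
Implicit Types (A : set V) (f g : V -> R).

Lemma derive_eq_on A f g v x : open A -> (forall y, A y -> f y = g y) ->
  A x -> 'D_v f x = 'D_v g x.
Proof.
move=> oA fg Ax; apply: near_eq_derive.
by apply: filterS (open_nbhs_nbhs (conj oA Ax)) => z /fg.
Qed.

Lemma eq_smooth_on A f g : open A -> (forall y, A y -> f y = g y) ->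
  smooth_on A f -> smooth_on A g.
Proof.
move=> oA fg sf s x Ax; apply: (eq_differentiable_iter oA _ Ax (sf s x Ax)).
by move=> y /set_mem /fg.
Qed.

Lemma smooth_derivable A f x v : smooth_on A f -> A x -> derivable f x v.
Proof. by move=> sf Ax; apply: diff_derivable; exact: (sf [::]). Qed.

Lemma smooth_on_cst A (c : R) : smooth_on A (fun=> c).
Proof.
move=> s; elim: s c => [c x _|v s IH c x Ax]; first exact: differentiable_cst.
rewrite /=; have -> : 'D_v (fun=> c) = fun=> 0 :> R.
  by apply/funext => y; exact: derive_cst.
exact: IH.
Qed.

Lemma smooth_onN A f : open A -> smooth_on A f -> smooth_on A (fun z => - f z).
Proof.
move=> oA sf.
have -> : (fun z => - f z) = (-1 : R) *: f.
  by apply/funext => z; rewrite fctE scaleN1r.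
exact: smooth_onZ.
Qed.

Lemma smooth_onB A f g : open A -> smooth_on A f -> smooth_on A g ->
  smooth_on A (fun z => f z - g z).
Proof. by move=> oA sf sg; apply: smooth_onD => //; exact: smooth_onN. Qed.

Lemma smooth_on_sum A (I : Type) (r : seq I) (P : pred I) (F : I -> V -> R) :
  open A -> (forall i, smooth_on A (F i)) ->
  smooth_on A (fun z => \sum_(i <- r | P i) F i z).
Proof.
move=> oA sF; elim: r => [|i r IH].
  under eq_fun do rewrite big_nil; exact: smooth_on_cst.
under eq_fun do rewrite big_cons; case: (P i) => //; exact: smooth_onD.
Qed.

Lemma smooth_on_prod A (I : Type) (r : seq I) (P : pred I) (F : I -> V -> R) :
  open A -> (forall i, smooth_on A (F i)) ->
  smooth_on A (fun z => \prod_(i <- r | P i) F i z).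
Proof.
move=> oA sF; elim: r => [|i r IH].
  under eq_fun do rewrite big_nil; exact: smooth_on_cst.
under eq_fun do rewrite big_cons; case: (P i) => //; exact: smooth_onM.
Qed.

(* Iterated derivatives up to order k; the inverse is handled by induction on
   the order because (1/f)' involves 1/f itself. *)
Let smooth_upto (k : nat) A f := forall (s : seq V) x, (size s <= k)%N ->
  A x -> differentiable (iter_derive s f) x.

(** [smooth_onM] asks for all orders, whereas in the induction on 1/f the factors are controlled
    only up to order [k]: Leibniz's rule is redone with the order bounded. *)
Let smooth_uptoM k A f g : open A -> smooth_upto k A f -> smooth_upto k A g ->
  smooth_upto k A (f * g).
Proof.
move=> oA; elim: k f g => [|k IH] f g sf sg [|v s] x //= sk Ax.
- by apply: differentiableM; [exact: (sf [::])|exact: (sg [::])].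
- by apply: differentiableM; [exact: (sf [::])|exact: (sg [::])].
apply: (@eq_differentiable_iter _ _ _ A (f * 'D_v g + g * 'D_v f) _ s) => //.
  move=> y /set_mem Ay; rewrite deriveM //; apply: diff_derivable.
    exact: (sf [::]).
  exact: (sg [::]).
have lo h : smooth_upto k.+1 A h -> smooth_upto k A h.
  by move=> sh t y tk; apply: sh; exact: leqW.
have hi h : smooth_upto k.+1 A h -> smooth_upto k A ('D_v h).
  by move=> sh t y tk; exact: (sh (v :: t)).
apply: (@differentiable_iterD _ _ _ A) => // t y ts Ay.
  exact: (IH _ _ (lo _ sf) (hi _ sg) t y (leq_trans ts sk) Ay).
exact: (IH _ _ (lo _ sg) (hi _ sf) t y (leq_trans ts sk) Ay).
Qed.

Lemma smooth_onV A f : open A -> (forall x, A x -> f x != 0) ->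
  smooth_on A f -> smooth_on A (fun z => (f z)^-1).
Proof.
move=> oA f0 sf.
suff H k : smooth_upto k A (fun z => (f z)^-1).
  by move=> s x Ax; exact: (H (size s)).
have dV x : A x -> differentiable (fun z => (f z)^-1) x.
  by move=> Ax; apply: differentiableV; [exact: (sf [::])|exact: f0].
elim: k => [|k IH] [|v s] x //= sk Ax; try exact: dV.
apply: (@eq_differentiable_iter _ _ _ A
  (((fun z => (f z)^-1) * (fun z => (f z)^-1)) * (fun z => - 'D_v f z)) _ s) => //.
  move=> y /set_mem Ay; rewrite deriveV; [|exact: f0|exact: smooth_derivable sf Ay].
  by rewrite !fctE /= scaleNr mulrN -invfM -expr2.
apply: (smooth_uptoM oA) sk Ax; first exact: smooth_uptoM.
by move=> t y _ Ay; apply: (smooth_onN oA (smooth_on_derive _ sf)).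
Qed.

Lemma smooth_on_det n A (M : V -> 'M[R]_n) : open A ->
  (forall i j, smooth_on A (fun z => M z i j)) -> smooth_on A (fun z => \det (M z)).
Proof.
move=> oA sM; rewrite /determinant; apply: smooth_on_sum => // s.
apply: smooth_onM => //; first exact: smooth_on_cst.
exact: smooth_on_prod.
Qed.

(** Cramer's rule: an entry of the inverse is a cofactor, polynomial in the entries, over a
    determinant that does not vanish on [A]. *)
Lemma smooth_on_invmx n A (M : V -> 'M[R]_n) i j : open A ->
  (forall x, A x -> M x \in unitmx) ->
  (forall i j, smooth_on A (fun z => M z i j)) ->
  smooth_on A (fun z => invmx (M z) i j).
Proof.
move=> oA uM sM.
apply: (@eq_smooth_on _ (fun z => (\det (M z))^-1 * cofactor (M z) j i)) => //.
  by move=> y Ay; rewrite /invmx uM // !mxE.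
apply: smooth_onM => //.
  apply: smooth_onV => //; last exact: smooth_on_det.
  by move=> x /uM; rewrite unitmxE unitfE.
rewrite /cofactor; apply: smooth_onM => //; first exact: smooth_on_cst.
apply: smooth_on_det => // k l.
by under eq_fun do rewrite !mxE; exact: sM.
Qed.

End SmoothCalculus.

(** * Composition with linear maps *)

Section LinearPullback.
Context {R : realType} {V W : normedModType R}.

(** Both sides are limits of the same difference quotient, by linearity of [p]; this is why no
    differentiability of [f] is assumed. *)
Lemma derive_lin_comp (p : {linear V -> W}) (f : W -> R) v :
  'D_v (f \o p) = 'D_(p v) f \o p.
Proof.
by apply/funext => x; rewrite /derive /=; under eq_fun do rewrite linearP.
Qed.

Lemma smooth_on_comp (p : {linear V -> W}) (A : set W) (f : W -> R) :
  continuous p -> smooth_on A f -> smooth_on (p @^-1` A) (f \o p).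
Proof.
move=> cp + s; elim: s f => [|v s IH] f sf x Ax.
  apply: differentiable_comp; first exact: linear_differentiable.
  exact: (sf [::]).
rewrite /= derive_lin_comp; apply: IH => //; exact: smooth_on_derive.
Qed.

Lemma smooth_on_linear (p : {linear V -> R^o}) A :
  continuous p -> smooth_on A (p : V -> R).
Proof.
move=> cp [|v s] x Ax; first exact: linear_differentiable.
rewrite /=; have -> : 'D_v (p : V -> R) = fun=> p v.
  by apply/funext => y; rewrite deriveE ?diff_lin //; exact: linear_differentiable.
exact: (@smooth_on_cst R V A).
Qed.

End LinearPullback.

(** * Symmetry of mixed second derivatives *)

Section Schwarz.
Context {R : realType} {V : normedModType R}.
Implicit Types (A : set V) (f : V -> R).

(** Restriction to a line turns a directional derivative into an ordinary one, so that the mean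
    value theorem on the real line becomes applicable. *)
Let is_derive_line f (a v : V) (t : R) : differentiable f (a + t *: v) ->
  is_derive t 1 (fun s : R => f (a + s *: v)) ('D_v f (a + t *: v)).
Proof.
move=> df.
have H : (fun h : R => h^-1 *: (f (a + (h *: (1 : R^o) + t) *: v) - f (a + t *: v))) =
   (fun h => h^-1 *: ((f \o shift (a + t *: v)) (h *: v) - f (a + t *: v))).
  apply/funext => h /=; congr (_ *: (f _ - _)).
  by rewrite scalerDl -[h *: 1]/(h * 1) mulr1 addrCA.
have dv := @diff_derivable _ _ _ f (a + t *: v) v df.
split.
  by rewrite /derivable /= H.
by rewrite /derive /= H.
Qed.

(* The second difference of f along h v and h w is h^2 times a second
   derivative at a nearby point, by two applications of the mean value theorem. *)
Let second_difference A f v w (a : V) (e : R) :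
  open A -> smooth_on A f -> A a -> 0 < e ->
  \forall h \near 0^'+, exists2 c : R, `| c - 'D_w ('D_v f) a | < e &
    f (a + h *: v + h *: w) - f (a + h *: v) - (f (a + h *: w) - f a) = h ^+ 2 * c.
Proof.
move=> oA sf Aa e0.
pose g := 'D_w ('D_v f).
have cg : g b @[b --> a] --> g a.
  by apply: differentiable_continuous; exact: (sf [:: v; w]).
have : nbhs a (A `&` [set b | `|'D_w ('D_v f) b - 'D_w ('D_v f) a| < e]).
  apply: filterI; first exact: open_nbhs_nbhs.
  have := @cvgr_distC_lt _ _ _ _ _ g (g a) cg e e0; exact.
case/nbhs_ballP => r /= r0 Ur.
(* Steps shorter than [d] along [v] and [w] stay in the ball of radius [r]; the summand 1 keeps the
   denominator positive when [v] and [w] both vanish. *)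
pose d := r / (`|v| + `|w| + 1).
have k0 : 0 < `|v| + `|w| + 1 by rewrite ltr_wpDl // addr_ge0.
have d0 : 0 < d by rewrite divr_gt0.
have near_a s t : 0 <= s < d -> 0 <= t < d ->
    (A `&` [set b | `|'D_w ('D_v f) b - 'D_w ('D_v f) a| < e]) (a + s *: v + t *: w).
  move=> /andP[s0 sd] /andP[t0 td]; apply: Ur.
  rewrite -ball_normE /= -addrA opprD addrA subrr add0r normrN.
  apply: (le_lt_trans (ler_normD _ _)); rewrite !normrZ !ger0_norm //.
  apply: (@le_lt_trans _ _ (d * (`|v| + `|w|))).
    by rewrite mulrDr lerD // ler_wpM2r // ltW.
  rewrite /d mulrAC -mulrA gtr_pMr // ltr_pdivrMr //.
  by rewrite mul1r ltrDl.
near=> h.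
have h0 : 0 < h by near: h; exact: nbhs_right_gt.
have hd : h < d by near: h; exact: nbhs_right_lt.
have h0d : 0 <= h < d by rewrite ltW.
have in0h (s : R) : s \in `]0, h[ -> 0 <= s < d.
  by rewrite in_itv /= => /andP[/ltW -> /lt_trans]; exact.
have in0hc (s : R) : s \in `[0, h] -> 0 <= s < d.
  by rewrite in_itv /= => /andP[-> /le_lt_trans]; exact.
(* The second difference is [F h - F 0], and the derivative [dF] is itself an increment of ['D_v f]
   in the direction [w], ready for the second mean value theorem. *)
pose F (s : R) := f (a + h *: w + s *: v) - f (a + s *: v).
pose dF (s : R) := 'D_v f (a + h *: w + s *: v) - 'D_v f (a + s *: v).
have dif (u : seq V) s t : 0 <= s < d -> 0 <= t < d ->
    differentiable (iter_derive u f) (a + s *: v + t *: w).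
  by move=> sd td; apply: sf; exact: (near_a s t sd td).1.
have z0 : (0 : R) <= 0 < d by rewrite lexx.
have dFs s : 0 <= s < d -> is_derive s 1 F (dF s).
  move=> sd; apply: is_deriveB.
    by apply: is_derive_line; rewrite addrAC; exact: (dif [::]).
  by apply: is_derive_line; have := dif [::] _ _ sd z0; rewrite scale0r addr0.
have [s sI] : exists2 s, s \in `]0, h[ & F h - F 0 = dF s * (h - 0).
  apply: (@MVT _ F dF 0 h h0) => [s /in0h sd|]; first exact: dFs.
  apply: derivable_within_continuous => s /in0hc sd.
  by case: (dFs s sd).
have sd := in0h _ sI; rewrite subr0 => eF.
pose G (t : R) := 'D_v f (a + s *: v + t *: w).
pose dG (t : R) := 'D_w ('D_v f) (a + s *: v + t *: w).
have dGt t : 0 <= t < d -> is_derive t 1 G (dG t).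
  by move=> td; apply: is_derive_line; exact: (dif [:: v]).
have [t tI] : exists2 t, t \in `]0, h[ & G h - G 0 = dG t * (h - 0).
  apply: (@MVT _ G dG 0 h h0) => [t /in0h td|]; first exact: dGt.
  apply: derivable_within_continuous => t /in0hc td.
  by case: (dGt t td).
have td := in0h _ tI; rewrite subr0 /G /dG scale0r addr0 => eG.
exists ('D_w ('D_v f) (a + s *: v + t *: w)).
  exact: (near_a s t sd td).2.
have -> : f (a + h *: v + h *: w) - f (a + h *: v) - (f (a + h *: w) - f a) = F h - F 0.
  by rewrite /F !scale0r !addr0 (addrAC a).
rewrite eF /dF (addrAC a) eG.
by rewrite mulrAC -mulrA mulrC expr2 -mulrA mulrCA.
Unshelve. all: by end_near. Qed.

(** The second difference is symmetric in [v] and [w]. For one small [h] it is h^2 times a number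
    within e/2 of each mixed derivative, and after cancelling h^2 this number is the same for
    both. *)
Lemma derive_comm A f v w a : open A -> smooth_on A f -> A a ->
  'D_v ('D_w f) a = 'D_w ('D_v f) a.
Proof.
move=> oA sf Aa; apply/eqP; rewrite -subr_eq0 -normr_le0.
apply/ler_addgt0Pl => e e0; rewrite addr0.
have e2 : 0 < e / 2 by rewrite divr_gt0.
have [h [h0 [c1 ce1 E1] [c2 ce2 E2]]] : exists h : R, [/\ 0 < h,
    exists2 c : R, `| c - 'D_w ('D_v f) a | < e / 2 &
      f (a + h *: v + h *: w) - f (a + h *: v) - (f (a + h *: w) - f a) = h ^+ 2 * c &
    exists2 c : R, `| c - 'D_v ('D_w f) a | < e / 2 &
      f (a + h *: w + h *: v) - f (a + h *: w) - (f (a + h *: v) - f a) = h ^+ 2 * c].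
  apply: (@filter_ex _ (0^'+ : set_system R)); near=> h; split.
  - by near: h; exact: nbhs_right_gt.
  - by near: h; exact: second_difference oA sf Aa e2.
  - by near: h; exact: second_difference oA sf Aa e2.
have c12 : c1 = c2.
  have h2 : h ^+ 2 != 0 by rewrite expf_neq0 // gt_eqF.
  by apply: (mulfI h2); rewrite -E1 -E2 (addrAC a); ring.
rewrite c12 {c12 E1} in ce1.
move: ('D_v ('D_w f) a) ('D_w ('D_v f) a) ce1 ce2 => x y cy cx.
have -> : x - y = (c2 - y) - (c2 - x) by ring.
by rewrite (splitr e) (le_trans (ler_normB _ _)) // ltW // ltrD.
Unshelve. all: by end_near. Qed.
End Schwarz.

(** * Local Finsler geometry *)

Section VelocityCoordinate.
Context {R : realType} {n : nat}.

(** Typed in [R^o] so as to be a linear map between modules: its smoothness and derivatives then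
    come from linearity. *)
Definition vel_coord (k : 'I_n) (z : phase R n) : R^o := z.2 0 k.

Let vel_coord_linear k : linear (vel_coord k).
Proof. by move=> a u v; rewrite /vel_coord /= !mxE. Qed.

HB.instance Definition _ k :=
  GRing.isLinear.Build R (phase R n) R^o _ (vel_coord k) (vel_coord_linear k).

Lemma vel_coord_continuous k : continuous (vel_coord k).
Proof.
move=> z; apply: (@continuous_comp _ _ _ snd (fun v : 'rV[R]_n => v 0 k)).
  exact: cvg_snd.
exact: coord_continuous.
Qed.

Lemma smooth_vel_coord A (k : 'I_n) : smooth_on A (fun z : phase R n => z.2 0 k).
Proof. exact: (@smooth_on_linear R _ (vel_coord k) A (@vel_coord_continuous k)). Qed.

Lemma dvel_vel_coord (i k : 'I_n) z :
  dvel i (fun z : phase R n => z.2 0 k) z = (k == i)%:R.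
Proof.
rewrite /dvel deriveE.
  rewrite (@diff_lin _ _ _ (vel_coord k)); last exact: vel_coord_continuous.
  by rewrite -[LHS]/((delta_mx 0 i : 'rV[R]_n) 0 k) mxE eqxx.
exact: (@smooth_vel_coord setT k [::] z).
Qed.
End VelocityCoordinate.

(** * Rules for [dpos], [dvel] and [hdelta]; smoothness of the Finsler objects *)

Section LocalFinslerCalculus.
Context {R : realType} {n : nat}.
Variable A : set (phase R n).
Hypothesis oA : open A.
Implicit Types (f g L : phase R n -> R).

Lemma smooth_dpos i f : smooth_on A f -> smooth_on A (dpos i f).
Proof. exact: smooth_on_derive. Qed.

Lemma smooth_dvel i f : smooth_on A f -> smooth_on A (dvel i f).
Proof. exact: smooth_on_derive. Qed.

Lemma eq_dpos i f g z : (forall y, A y -> f y = g y) -> A z -> dpos i f z = dpos i g z.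
Proof. exact: derive_eq_on. Qed.

Lemma eq_dvel i f g z : (forall y, A y -> f y = g y) -> A z -> dvel i f z = dvel i g z.
Proof. exact: derive_eq_on. Qed.

Lemma dposD i f g z : smooth_on A f -> smooth_on A g -> A z ->
  dpos i (fun w => f w + g w) z = dpos i f z + dpos i g z.
Proof. by move=> sf sg Az; apply: deriveD; exact: smooth_derivable Az. Qed.

Lemma dvelD i f g z : smooth_on A f -> smooth_on A g -> A z ->
  dvel i (fun w => f w + g w) z = dvel i f z + dvel i g z.
Proof. by move=> sf sg Az; apply: deriveD; exact: smooth_derivable Az. Qed.

Lemma dposB i f g z : smooth_on A f -> smooth_on A g -> A z ->
  dpos i (fun w => f w - g w) z = dpos i f z - dpos i g z.
Proof. by move=> sf sg Az; apply: deriveB; exact: smooth_derivable Az. Qed.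

Lemma dvelB i f g z : smooth_on A f -> smooth_on A g -> A z ->
  dvel i (fun w => f w - g w) z = dvel i f z - dvel i g z.
Proof. by move=> sf sg Az; apply: deriveB; exact: smooth_derivable Az. Qed.

Lemma dposM i f g z : smooth_on A f -> smooth_on A g -> A z ->
  dpos i (fun w => f w * g w) z = dpos i f z * g z + f z * dpos i g z.
Proof.
move=> sf sg Az; rewrite /dpos (deriveM (f := f) (g := g)) //;
  try exact: smooth_derivable Az.
by rewrite addrC [X in X + _]mulrC.
Qed.

Lemma dvelM i f g z : smooth_on A f -> smooth_on A g -> A z ->
  dvel i (fun w => f w * g w) z = dvel i f z * g z + f z * dvel i g z.
Proof.
move=> sf sg Az; rewrite /dvel (deriveM (f := f) (g := g)) //;
  try exact: smooth_derivable Az.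
by rewrite addrC [X in X + _]mulrC.
Qed.

Lemma dvel_sum (I : finType) i (F : I -> phase R n -> R) z :
  (forall j, smooth_on A (F j)) -> A z ->
  dvel i (fun w => \sum_j F j w) z = \sum_j dvel i (F j) z.
Proof.
move=> sF Az; elim: (index_enum I) => [|j r IH].
  by under eq_fun do rewrite big_nil; rewrite big_nil /dvel derive_cst.
under eq_fun do rewrite big_cons.
by rewrite big_cons dvelD ?IH //; exact: smooth_on_sum.
Qed.

Section Hdelta.
Variable L : phase R n -> R.

Lemma eq_hdelta i f g z : (forall y, A y -> f y = g y) -> A z ->
  hdelta L i f z = hdelta L i g z.
Proof.
move=> fg Az; rewrite /hdelta (eq_dpos _ fg) //; congr (_ - _).
by apply: eq_bigr => j _; rewrite (eq_dvel _ fg).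
Qed.

Lemma hdeltaB i f g z : smooth_on A f -> smooth_on A g -> A z ->
  hdelta L i (fun w => f w - g w) z = hdelta L i f z - hdelta L i g z.
Proof.
move=> sf sg Az; rewrite /hdelta dposB //.
under eq_bigr do rewrite dvelB // mulrBr.
by rewrite sumrB; ring.
Qed.

Lemma hdeltaM i f g z : smooth_on A f -> smooth_on A g -> A z ->
  hdelta L i (fun w => f w * g w) z = hdelta L i f z * g z + f z * hdelta L i g z.
Proof.
move=> sf sg Az; rewrite /hdelta dposM //.
under eq_bigr do rewrite dvelM // mulrDr mulrA (mulrCA _ (f z)).
by rewrite big_split /= -mulr_suml -mulr_sumr; ring.
Qed.

(** Leibniz's rule on f * f^{-1} = 1: once the derivative of f vanishes, only f times the derivative
    of f^{-1} is left. *)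
Lemma hdeltaV i f z : smooth_on A f -> (forall y, A y -> f y != 0) -> A z ->
  hdelta L i f z = 0 -> hdelta L i (fun w => (f w)^-1) z = 0.
Proof.
move=> sf f0 Az df0.
have sV := smooth_onV oA f0 sf.
have := hdeltaM i sf sV Az.
rewrite df0 mul0r add0r (@eq_hdelta i _ (fun=> 1)) //; last first.
  by move=> y /f0 fy; rewrite divff.
rewrite {1}/hdelta /dpos /dvel derive_cst big1 ?subr0 => [|j _]; last first.
  by rewrite derive_cst mulr0.
by move/esym/eqP; rewrite mulf_eq0 (negPf (f0 z Az)) => /eqP.
Qed.

Lemma hdeltaZ i (c : R) f z : smooth_on A f -> A z ->
  hdelta L i (fun w => c * f w) z = c * hdelta L i f z.
Proof.
move=> sf Az; rewrite hdeltaM //; last exact: smooth_on_cst.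
rewrite {1}/hdelta /dpos /dvel derive_cst big1 ?subr0 ?mul0r ?add0r // => j _.
by rewrite derive_cst mulr0.
Qed.
End Hdelta.

Section Smoothness.
Variable L : phase R n -> R.
Hypothesis sL : smooth_on A L.

Lemma glowE i j z : glow L i j z = 2^-1 * dvel i (dvel j L) z.
Proof. by rewrite /glow mxE. Qed.

Lemma glow_sym i j z : A z -> glow L i j z = glow L j i z.
Proof. by move=> Az; rewrite !glowE /dvel (derive_comm _ _ oA). Qed.

Lemma gup_sym i j z : A z -> gup L i j z = gup L j i z.
Proof.
move=> Az; have gT : (gmx L z)^T = gmx L z.
  by apply/matrixP => k l; rewrite mxE; exact: glow_sym.
by rewrite /gup -{1}gT -trmx_inv mxE.
Qed.

Lemma smooth_glow i j : smooth_on A (glow L i j).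
Proof.
apply: (@eq_smooth_on _ _ _ (fun z => 2^-1 * dvel i (dvel j L) z)) => //.
  by move=> z _; rewrite glowE.
by apply: smooth_onM => //; [exact: smooth_on_cst|do 2!apply: smooth_dvel].
Qed.

Hypothesis uL : forall z, A z -> gmx L z \in unitmx.

Lemma sum_glow_gup i j z : A z -> \sum_k glow L i k z * gup L k j z = (i == j)%:R.
Proof. by move=> Az; have := mulmxV (uL Az) => /matrixP/(_ i j); rewrite !mxE. Qed.

Lemma sum_gup_glow i j z : A z -> \sum_k gup L i k z * glow L k j z = (i == j)%:R.
Proof. by move=> Az; have := mulVmx (uL Az) => /matrixP/(_ i j); rewrite !mxE. Qed.

Lemma smooth_gup i j : smooth_on A (gup L i j).
Proof. apply: smooth_on_invmx => //; exact: smooth_glow. Qed.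

Lemma smooth_spray i : smooth_on A (spray L i).
Proof.
apply: smooth_onM => //; first exact: smooth_on_cst.
apply: smooth_on_sum => // j; apply: smooth_onM => //; first exact: smooth_gup.
apply: smooth_onB => //; last exact: smooth_dpos.
apply: smooth_on_sum => // k; apply: smooth_onM => //.
  by apply: smooth_dvel; exact: smooth_dpos.
exact: smooth_vel_coord.
Qed.

Lemma smooth_hdelta i f : smooth_on A f -> smooth_on A (hdelta L i f).
Proof.
move=> sf; apply: smooth_onB => //; first exact: smooth_dpos.
apply: smooth_on_sum => // j; apply: smooth_onM => //; last exact: smooth_dvel.
by apply: smooth_dvel; exact: smooth_spray.
Qed.

Lemma smooth_conn k i j : smooth_on A (conn L k i j).
Proof.
apply: smooth_onM => //; first exact: smooth_on_cst.
apply: smooth_on_sum => // e; apply: smooth_onM => //; first exact: smooth_gup.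
apply: smooth_onB => //; last by apply: smooth_hdelta; exact: smooth_glow.
by apply: smooth_onD => //; apply: smooth_hdelta; exact: smooth_glow.
Qed.

Lemma conn_sym k i j z : A z -> conn L k i j z = conn L k j i z.
Proof.
move=> Az; rewrite /conn; congr (_ * _); apply: eq_bigr => e _; congr (_ * (_ - _)).
  by rewrite addrC.
by apply: eq_hdelta => // y Ay; exact: glow_sym.
Qed.
End Smoothness.
End LocalFinslerCalculus.

(* L is the square of a Finsler metric and h that of a warping function, read
   in a chart over the phase domain A; Euler's relation for the 1-homogeneous
   functions dL/dy^i is the only trace of homogeneity that is used. *)
Record warped_factor (R : realType) (n : nat) (L h : phase R n -> R)
    (A : set (phase R n)) : Prop := WarpedFactor {
  factor_open : open A;
  factor_smooth : smooth_on A L;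
  factor_unit : forall z, A z -> gmx L z \in unitmx;
  factor_euler : forall i z, A z ->
    \sum_k dvel k (dvel i L) z * z.2 0 k = dvel i L z;
  warp_smooth : smooth_on A h;
  warp_neq0 : forall z, A z -> h z != 0;
  warp_base : forall i z, dvel i h z = 0 }.

(** * The block metric of the product *)

Section Projection.
Context {R : realType} {N n : nat}.
Variable e : 'I_n -> 'I_N.

(** Reindexing along an arbitrary [e] makes the projections onto the two factors instances of one
    linear map, through which derivatives are pulled back. *)
Definition subphase (z : phase R N) : phase R n :=
  (\row_j z.1 0 (e j), \row_j z.2 0 (e j)).

Let proj_linear : linear subphase.
Proof.
by move=> a u v; congr (_, _); apply/rowP => j; rewrite !mxE.
Qed.

HB.instance Definition _ :=
  GRing.isLinear.Build R (phase R N) (phase R n) _ subphase proj_linear.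

(** Every coordinate of the image is a coordinate of the source, so a ball is sent into the ball of
    the same radius. *)
Lemma proj_continuous : continuous subphase.
Proof.
move=> z B /nbhs_ballP[eps /= eps0 epsB].
apply/nbhs_ballP; exists eps => //= v [[_ zv1] [_ zv2]]; apply: epsB.
split; split => // i j.
  by apply: (le_lt_trans _ (zv1 0 (e j))); rewrite !mxE.
by apply: (le_lt_trans _ (zv2 0 (e j))); rewrite !mxE.
Qed.

Implicit Types (f : phase R n -> R).

Lemma smooth_on_proj (A : set (phase R n)) f :
  smooth_on A f -> smooth_on (subphase @^-1` A) (fun z => f (subphase z)).
Proof. exact: (smooth_on_comp proj_continuous). Qed.

Let derive_proj f v z :
  'D_v (fun z => f (subphase z)) z = 'D_(subphase v) f (subphase z).
Proof. by have := derive_lin_comp subphase f v => /(congr1 (@^~ z)). Qed.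

Let row_delta (a : 'I_N) (i : 'I_n) : (forall j, (e j == a) = (j == i)) ->
  \row_j (delta_mx 0 a : 'rV[R]_N) 0 (e j) = delta_mx 0 i.
Proof. by move=> ea; apply/rowP => j; rewrite !mxE ea. Qed.

Let row_delta0 (a : 'I_N) : (forall j, e j != a) ->
  \row_j (delta_mx 0 a : 'rV[R]_N) 0 (e j) = 0.
Proof. by move=> ea; apply/rowP => j; rewrite !mxE (negPf (ea j)). Qed.

Let row0 : \row_j (0 : 'rV[R]_N) 0 (e j) = 0.
Proof. by apply/rowP => j; rewrite !mxE. Qed.

Lemma dpos_proj f i z : injective e ->
  dpos (e i) (fun z => f (subphase z)) z = dpos i f (subphase z).
Proof.
move=> ie; rewrite /dpos derive_proj /subphase /= row0 (@row_delta _ i) //.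
by move=> j; rewrite inj_eq.
Qed.

Lemma dvel_proj f i z : injective e ->
  dvel (e i) (fun z => f (subphase z)) z = dvel i f (subphase z).
Proof.
move=> ie; rewrite /dvel derive_proj /subphase /= row0 (@row_delta _ i) //.
by move=> j; rewrite inj_eq.
Qed.

Lemma dpos_proj0 f a z : (forall j, e j != a) -> dpos a (fun z => f (subphase z)) z = 0.
Proof. by move=> ea; rewrite /dpos derive_proj /subphase /= row0 row_delta0 // derive0. Qed.

Lemma dvel_proj0 f a z : (forall j, e j != a) -> dvel a (fun z => f (subphase z)) z = 0.
Proof. by move=> ea; rewrite /dvel derive_proj /subphase /= row0 row_delta0 // derive0. Qed.
End Projection.

(* The coordinates of the product are split along e1 and e2, so that exchanging
   the factors becomes a symmetry of all the statements below. *)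
Record doubly_warped (R : realType) (N n1 n2 : nat)
    (e1 : 'I_n1 -> 'I_N) (e2 : 'I_n2 -> 'I_N)
    (L1 h1 : phase R n1 -> R) (A1 : set (phase R n1))
    (L2 h2 : phase R n2 -> R) (A2 : set (phase R n2))
    (L : phase R N -> R) : Prop := DoublyWarped {
  split_inj1 : injective e1;
  split_inj2 : injective e2;
  split_disj : forall i a, e1 i != e2 a;
  split_sum : forall F : 'I_N -> R, \sum_b F b = \sum_i F (e1 i) + \sum_a F (e2 a);
  split_cover : forall b, (exists i, b = e1 i) \/ (exists a, b = e2 a);
  factor1 : warped_factor L1 h1 A1;
  factor2 : warped_factor L2 h2 A2;
  doubly_warpedE : L = fun z =>
    h2 (subphase e2 z) * L1 (subphase e1 z) + h1 (subphase e1 z) * L2 (subphase e2 z) }.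

Lemma doubly_warped_sym (R : realType) (N n1 n2 : nat)
    (e1 : 'I_n1 -> 'I_N) (e2 : 'I_n2 -> 'I_N)
    (L1 h1 : phase R n1 -> R) (A1 : set (phase R n1))
    (L2 h2 : phase R n2 -> R) (A2 : set (phase R n2)) L :
  doubly_warped e1 e2 L1 h1 A1 L2 h2 A2 L -> doubly_warped e2 e1 L2 h2 A2 L1 h1 A1 L.
Proof.
case=> i1 i2 d s c w1 w2 LE; split=> //.
- by move=> a i; rewrite eq_sym.
- by move=> F; rewrite s addrC.
- by move=> b; case: (c b); [right|left].
- by rewrite LE; apply/funext => z; rewrite addrC.
Qed.

(** * Derivatives and metric block along one factor *)

Section FirstFactor.
Context {R : realType} {N n1 n2 : nat}.
Context {e1 : 'I_n1 -> 'I_N} {e2 : 'I_n2 -> 'I_N}.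
Context {L1 h1 : phase R n1 -> R} {A1 : set (phase R n1)}.
Context {L2 h2 : phase R n2 -> R} {A2 : set (phase R n2)}.
Context {L : phase R N -> R}.
Hypothesis D : doubly_warped e1 e2 L1 h1 A1 L2 h2 A2 L.

Local Notation p1 := (subphase e1).
Local Notation p2 := (subphase e2).

Let A : set (phase R N) := [set z | A1 (p1 z) /\ A2 (p2 z)].

Lemma split_disj21 a i : e2 a != e1 i.
Proof. by rewrite eq_sym; exact: split_disj D i a. Qed.

Lemma open_dom : open A.
Proof.
apply: openI.
  apply: (open_comp (f := p1)) (factor_open (factor1 D)) => z _.
  exact: proj_continuous.
apply: (open_comp (f := p2)) (factor_open (factor2 D)) => z _.
exact: proj_continuous.
Qed.

Lemma smooth_p1 (f : phase R n1 -> R) : smooth_on A1 f -> smooth_on A (fun z => f (p1 z)).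
Proof. by move=> sf s z [Az _]; exact: (smooth_on_proj sf). Qed.

Lemma smooth_p2 (f : phase R n2 -> R) : smooth_on A2 f -> smooth_on A (fun z => f (p2 z)).
Proof. by move=> sf s z [_ Az]; exact: (smooth_on_proj sf). Qed.

Lemma smooth_h1 : smooth_on A (fun z => h1 (p1 z)).
Proof. exact/smooth_p1/(warp_smooth (factor1 D)). Qed.
Lemma smooth_h2 : smooth_on A (fun z => h2 (p2 z)).
Proof. exact/smooth_p2/(warp_smooth (factor2 D)). Qed.
Lemma smooth_L1 : smooth_on A (fun z => L1 (p1 z)).
Proof. exact/smooth_p1/(factor_smooth (factor1 D)). Qed.
Lemma smooth_L2 : smooth_on A (fun z => L2 (p2 z)).
Proof. exact/smooth_p2/(factor_smooth (factor2 D)). Qed.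

Lemma smooth_product : smooth_on A L.
Proof.
rewrite (doubly_warpedE D); apply: smooth_onD open_dom _ _.
  exact: smooth_onM open_dom smooth_h2 smooth_L1.
exact: smooth_onM open_dom smooth_h1 smooth_L2.
Qed.

Lemma dpos1_p1 (f : phase R n1 -> R) i z : dpos (e1 i) (fun z => f (p1 z)) z = dpos i f (p1 z).
Proof. exact/dpos_proj/(split_inj1 D). Qed.
Lemma dvel1_p1 (f : phase R n1 -> R) i z : dvel (e1 i) (fun z => f (p1 z)) z = dvel i f (p1 z).
Proof. exact/dvel_proj/(split_inj1 D). Qed.
Lemma dpos1_p2 (f : phase R n2 -> R) i z : dpos (e1 i) (fun z => f (p2 z)) z = 0.
Proof. by apply: dpos_proj0 => a; exact: split_disj21. Qed.
Lemma dvel1_p2 (f : phase R n2 -> R) i z : dvel (e1 i) (fun z => f (p2 z)) z = 0.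
Proof. by apply: dvel_proj0 => a; exact: split_disj21. Qed.
Lemma dvel1_h1 i z : dvel (e1 i) (fun z => h1 (p1 z)) z = 0.
Proof. by rewrite dvel1_p1 (warp_base (factor1 D)). Qed.

Lemma dvel1_product i z : A z -> dvel (e1 i) L z = h2 (p2 z) * dvel i L1 (p1 z).
Proof.
move=> Az; have oA := open_dom; rewrite (doubly_warpedE D).
rewrite (dvelD _ _ _ Az); last 2 first.
- exact: smooth_onM oA smooth_h2 smooth_L1.
- exact: smooth_onM oA smooth_h1 smooth_L2.
rewrite (dvelM _ smooth_h2 smooth_L1 Az) (dvelM _ smooth_h1 smooth_L2 Az).
by rewrite !dvel1_p2 dvel1_h1 dvel1_p1 !mul0r mulr0 !addr0 add0r.
Qed.

Lemma dpos1_product i z : A z -> dpos (e1 i) L z =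
  h2 (p2 z) * dpos i L1 (p1 z) + dpos i h1 (p1 z) * L2 (p2 z).
Proof.
move=> Az; have oA := open_dom; rewrite (doubly_warpedE D).
rewrite (dposD _ _ _ Az); last 2 first.
- exact: smooth_onM oA smooth_h2 smooth_L1.
- exact: smooth_onM oA smooth_h1 smooth_L2.
rewrite (dposM _ smooth_h2 smooth_L1 Az) (dposM _ smooth_h1 smooth_L2 Az).
by rewrite !dpos1_p2 !dpos1_p1 mul0r mulr0 addr0 add0r.
Qed.

Lemma smooth_dvel1_L1 j : smooth_on A (fun z => dvel j L1 (p1 z)).
Proof. exact/smooth_p1/smooth_dvel/(factor_smooth (factor1 D)). Qed.
Lemma glow11 i j z : A z -> glow L (e1 i) (e1 j) z = h2 (p2 z) * glow L1 i j (p1 z).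
Proof.
move=> Az; rewrite !glowE mulrCA; congr (_ * _).
rewrite (eq_dvel open_dom _ (dvel1_product j) Az).
by rewrite (dvelM _ smooth_h2 (smooth_dvel1_L1 j) Az) dvel1_p2 dvel1_p1 mul0r add0r.
Qed.

Lemma smooth_glow1 i j : smooth_on A (fun z => glow L1 i j (p1 z)).
Proof.
exact/smooth_p1/(smooth_glow (factor_open (factor1 D)))/(factor_smooth (factor1 D)).
Qed.

End FirstFactor.

(** * Mixed blocks, non-degeneracy and inverse of the product metric *)

Section BothFactors.
Context {R : realType} {N n1 n2 : nat}.
Context {e1 : 'I_n1 -> 'I_N} {e2 : 'I_n2 -> 'I_N}.
Context {L1 h1 : phase R n1 -> R} {A1 : set (phase R n1)}.
Context {L2 h2 : phase R n2 -> R} {A2 : set (phase R n2)}.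
Context {L : phase R N -> R}.
Hypothesis D : doubly_warped e1 e2 L1 h1 A1 L2 h2 A2 L.

Local Notation p1 := (subphase e1).
Local Notation p2 := (subphase e2).
Local Notation A := [set z | A1 (p1 z) /\ A2 (p2 z)].

Let D' := doubly_warped_sym D.

Let swap z : A z -> [set z | A2 (p2 z) /\ A1 (p1 z)] z.
Proof. by case. Qed.

Lemma glow12 i a z : A z -> glow L (e1 i) (e2 a) z = 0.
Proof.
move=> Az; rewrite glowE.
have E y : A y -> dvel (e2 a) L y = h1 (p1 y) * dvel a L2 (p2 y).
  by move/swap/(dvel1_product D').
rewrite (eq_dvel (open_dom D) _ E Az) (dvelM _ (smooth_h1 D) _ Az); last first.
  exact/smooth_p2/smooth_dvel/(factor_smooth (factor2 D)).
by rewrite (dvel1_h1 D) (dvel1_p2 D) mul0r mulr0 addr0 mulr0.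
Qed.

Lemma glow21 i a z : A z -> glow L (e2 a) (e1 i) z = 0.
Proof.
by move=> Az; rewrite (glow_sym (open_dom D) (smooth_product D)) // glow12.
Qed.

Lemma glow22 a b z : A z -> glow L (e2 a) (e2 b) z = h1 (p1 z) * glow L2 a b (p2 z).
Proof. by move/swap/(glow11 D'). Qed.

(* Rows of a vector killed by the block metric are killed by each block. *)
Lemma product_unit z : A z -> gmx L z \in unitmx.
Proof.
move=> Az; rewrite -row_free_unit; apply: inj_row_free => v vg.
have [Az1 Az2] := Az.
have v1 : (\row_i v 0 (e1 i)) *m gmx L1 (p1 z) = 0.
  apply/rowP => j; move: vg => /rowP/(_ (e1 j)); rewrite !mxE (split_sum D).
  rewrite [X in _ + X]big1 ?addr0 => [|a _]; last by rewrite -/(glow _ _ _ _) glow21 // mulr0.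
  move=> vg; apply: (mulfI (warp_neq0 (factor2 D) Az2)); rewrite mulr0 mulr_sumr -[RHS]vg.
  apply: eq_bigr => i _; rewrite -/(glow L (e1 i) (e1 j) z) (glow11 D) //.
  by rewrite [in LHS]mxE mulrCA.
have v2 : (\row_a v 0 (e2 a)) *m gmx L2 (p2 z) = 0.
  apply/rowP => b; move: vg => /rowP/(_ (e2 b)); rewrite !mxE (split_sum D).
  rewrite big1 ?add0r => [|i _]; last by rewrite -/(glow _ _ _ _) glow12 // mulr0.
  move=> vg; apply: (mulfI (warp_neq0 (factor1 D) Az1)); rewrite mulr0 mulr_sumr -[RHS]vg.
  apply: eq_bigr => a _; rewrite -/(glow L (e2 a) (e2 b) z) glow22 //.
  by rewrite [in LHS]mxE mulrCA.
move/(congr1 (mulmx^~ (invmx (gmx L1 (p1 z))))): v1.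
rewrite mulmxK ?(factor_unit (factor1 D)) // mul0mx => /rowP v1.
move/(congr1 (mulmx^~ (invmx (gmx L2 (p2 z))))): v2.
rewrite mulmxK ?(factor_unit (factor2 D)) // mul0mx => /rowP v2.
apply/rowP => b; have [[i ->]|[a ->]] := split_cover D b.
  by have := v1 i; rewrite !mxE.
by have := v2 a; rewrite !mxE.
Qed.

(** The mixed block being zero, the rows [e1 j] of a column of the inverse metric, times f_2^2,
    solve a linear system with matrix g_ij alone. The column [b] is left arbitrary to yield both the
    pure and the mixed entries. *)
Let gup_block i (b : 'I_N) z : A z ->
  h2 (p2 z) * gup L (e1 i) b z = \sum_k gup L1 i k (p1 z) * (e1 k == b)%:R.
Proof.
move=> Az; have [Az1 Az2] := Az.
pose Y j := h2 (p2 z) * gup L (e1 j) b z.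
have gY k : \sum_j glow L1 k j (p1 z) * Y j = (e1 k == b)%:R.
  rewrite -(sum_glow_gup product_unit _ _ Az) (split_sum D) [X in _ + X]big1 ?addr0.
    by apply: eq_bigr => j _; rewrite (glow11 D) // /Y mulrCA mulrA.
  by move=> a _; rewrite glow12 // mul0r.
under [RHS]eq_bigr do rewrite -gY mulr_sumr.
rewrite exchange_big /= (bigD1 i) //= [X in _ + X]big1 => [|j ji].
  under eq_bigr do rewrite mulrA.
  rewrite -mulr_suml (sum_gup_glow _ _ _ Az1) ?eqxx ?mul1r ?addr0 //.
  exact: factor_unit (factor1 D).
under eq_bigr do rewrite mulrA.
rewrite -mulr_suml (sum_gup_glow _ _ _ Az1); last exact: factor_unit (factor1 D).
by rewrite eq_sym (negPf ji) mul0r.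
Qed.

Lemma gup11 i j z : A z ->
  gup L (e1 i) (e1 j) z = (h2 (p2 z))^-1 * gup L1 i j (p1 z).
Proof.
move=> Az; have h2N0 := warp_neq0 (factor2 D) Az.2.
apply: (mulfI h2N0); rewrite (gup_block _ _ Az) mulrA divff // mul1r.
rewrite (bigD1 j) //= eqxx mulr1 big1 ?addr0 // => k kj.
by rewrite (inj_eq (split_inj1 D)) (negPf kj) mulr0.
Qed.

Lemma gup12 i a z : A z -> gup L (e1 i) (e2 a) z = 0.
Proof.
move=> Az; have h2N0 := warp_neq0 (factor2 D) Az.2.
apply: (mulfI h2N0); rewrite (gup_block _ _ Az) mulr0 big1 // => k _.
by rewrite (negPf (split_disj D _ _)) mulr0.
Qed.

End BothFactors.

(** * The connection of the product *)

Section WarpedFactorTheory.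
Context {R : realType} {n : nat} {L h : phase R n -> R} {A : set (phase R n)}.
Hypothesis w : warped_factor L h A.

Lemma dvel_dpos_warp i j z : A z -> dvel i (dpos j h) z = 0.
Proof.
move=> Az; rewrite /dvel (derive_comm _ _ (factor_open w) (warp_smooth w) Az).
rewrite (_ : 'D_(0, delta_mx 0 i) h = cst 0) ?derive_cst //.
by apply/funext => y; exact: (warp_base w).
Qed.

(** Euler's relation reads dL/dy^j = 2 g_jk y^k, and g^{ij} cancels g_jk. *)
Lemma sum_gup_dvel i z : A z -> \sum_j gup L i j z * dvel j L z = 2 * z.2 0 i.
Proof.
move=> Az.
under eq_bigr => j _.
  rewrite -(factor_euler w) // mulr_sumr; over.
rewrite /= exchange_big /= (bigD1 i) //= [X in _ + X]big1 => [|k ki].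
  under eq_bigr => j _.
    rewrite (_ : _ * _ = (gup L i j z * glow L j i z) * (2 * z.2 0 i)); last first.
      by rewrite (glow_sym (factor_open w) (factor_smooth w)) // glowE; field.
    over.
  by rewrite /= -mulr_suml (sum_gup_glow (factor_unit w)) // eqxx mul1r addr0.
under eq_bigr => j _.
  rewrite (_ : _ * _ = (gup L i j z * glow L j k z) * (2 * z.2 0 k)); last first.
    by rewrite (glow_sym (factor_open w) (factor_smooth w)) // glowE; field.
  over.
by rewrite /= -mulr_suml (sum_gup_glow (factor_unit w)) // eq_sym (negPf ki) mul0r.
Qed.
End WarpedFactorTheory.

(** * The tensors of the statement in split coordinates *)

Section WarpTensors.
Variables (R : realType) (N n1 n2 : nat).
Variables (e1 : 'I_n1 -> 'I_N) (e2 : 'I_n2 -> 'I_N).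
Variables (L1 h1 : phase R n1 -> R) (L2 h2 : phase R n2 -> R) (L : phase R N -> R).
Local Notation p1 := (subphase e1).
Local Notation p2 := (subphase e2).

(* M^r_i *)
Definition warp_nonlin (r i : 'I_n1) (z : phase R N) : R :=
  (2 * h2 (p2 z))^-1 *
    (\sum_a dpos (e2 a) (fun w => h2 (p2 w)) z * z.2 0 (e2 a)) * (r == i)%:R
  - (4 * h2 (p2 z))^-1 * (\sum_h dvel (e1 i) (fun w => gup L1 r h (p1 w)) z
      * dpos (e1 h) (fun w => h1 (p1 w)) z) * L2 (p2 z).

(* M^i_jk *)
Definition warp_conn (i j k : 'I_n1) (z : phase R N) : R :=
  2^-1 * \sum_h gup L1 i h (p1 z) * \sum_r
    (warp_nonlin r k z * dvel (e1 r) (fun w => glow L1 h j (p1 w)) z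
     + warp_nonlin r j z * dvel (e1 r) (fun w => glow L1 h k (p1 w)) z
     - warp_nonlin r h z * dvel (e1 r) (fun w => glow L1 j k (p1 w)) z).

(* All mixed connection coefficients are contractions of this one. *)
Definition mixed_dglow (j k : 'I_n1) (a : 'I_n2) (z : phase R N) : R :=
  hdelta L (e2 a) (glow L (e1 j) (e1 k)) z.

(* 2 f_2^2 F^i_ka *)
Definition mixed_conn12 (i k : 'I_n1) (a : 'I_n2) (z : phase R N) : R :=
  dpos (e2 a) (fun w => h2 (p2 w)) z * (i == k)%:R
  - h2 (p2 z) * \sum_r \sum_h nonlin L (e1 r) (e2 a) z * gup L1 i h (p1 z)
      * dvel (e1 r) (fun w => glow L1 h k (p1 w)) z.

(* The same quantity with the transposed metric in the last derivative. *)
Definition mixed_conn12T (i k : 'I_n1) (a : 'I_n2) (z : phase R N) : R :=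
  dpos (e2 a) (fun w => h2 (p2 w)) z * (i == k)%:R
  - h2 (p2 z) * \sum_r \sum_h nonlin L (e1 r) (e2 a) z * gup L1 i h (p1 z)
      * dvel (e1 r) (fun w => glow L1 k h (p1 w)) z.

(* - 2 f_2^2 F^i_ab *)
Definition mixed_conn22 (i : 'I_n1) (a b : 'I_n2) (z : phase R N) : R :=
  (\sum_h dpos (e1 h) (fun w => h1 (p1 w)) z * gup L1 i h (p1 z) * glow L2 a b (p2 z))
  - h1 (p1 z) * \sum_c \sum_h nonlin L (e2 c) (e1 h) z * gup L1 i h (p1 z)
      * dvel (e2 c) (fun w => glow L2 a b (p2 w)) z.
End WarpTensors.

(** * Spray, nonlinear connection and connection coefficients *)

Section Connection.
Context {R : realType} {N n1 n2 : nat}.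
Context {e1 : 'I_n1 -> 'I_N} {e2 : 'I_n2 -> 'I_N}.
Context {L1 h1 : phase R n1 -> R} {A1 : set (phase R n1)}.
Context {L2 h2 : phase R n2 -> R} {A2 : set (phase R n2)}.
Context {L : phase R N -> R}.
Hypothesis D : doubly_warped e1 e2 L1 h1 A1 L2 h2 A2 L.

Local Notation p1 := (subphase e1).
Local Notation p2 := (subphase e2).
Local Notation A := [set z | A1 (p1 z) /\ A2 (p2 z)].

Local Notation warpM := (warp_nonlin e1 e2 L1 h1 L2 h2).
Local Notation warpT := (warp_conn e1 e2 L1 h1 L2 h2).
Local Notation warpP := (mixed_dglow e1 e2 L).

Let D' := doubly_warped_sym D.
Let w1 := factor1 D.
Let w2 := factor2 D.
Let oA := open_dom D.
Let oA1 := factor_open w1.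
Let oA2 := factor_open w2.

Let swap z : A z -> [set z | A2 (p2 z) /\ A1 (p1 z)] z.
Proof. by case. Qed.

(** The correction to the spray is [k2] times y^i minus [q1] times [c2]. [k2] and [c2] depend on the
    second factor alone, so differentiation in y only meets y^i and [q1]. *)
Let k2 y := (2 * h2 y)^-1 * \sum_a dpos a h2 y * y.2 0 a.
Let c2 y := (4 * h2 y)^-1 * L2 y.
Let q1 i y := \sum_h gup L1 i h y * dpos h h1 y.

Lemma dpos2_p2 (f : phase R n2 -> R) a z :
  dpos (e2 a) (fun z => f (p2 z)) z = dpos a f (p2 z).
Proof. exact: (dpos1_p1 D'). Qed.

Lemma dpos2_p1 (f : phase R n1 -> R) a z : dpos (e2 a) (fun z => f (p1 z)) z = 0.
Proof. exact: (dpos1_p2 D'). Qed.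

Lemma dvel2_p1 (f : phase R n1 -> R) a z : dvel (e2 a) (fun z => f (p1 z)) z = 0.
Proof. exact: (dvel1_p2 D'). Qed.

Let sL1 : smooth_on A1 L1 := factor_smooth w1.
Let sL2 : smooth_on A2 L2 := factor_smooth w2.
Let sh1 : smooth_on A1 h1 := warp_smooth w1.
Let sh2 : smooth_on A2 h2 := warp_smooth w2.

Let dvel1_dpos1 j k z : A z ->
  dvel (e1 j) (dpos (e1 k) L) z = h2 (p2 z) * dvel j (dpos k L1) (p1 z).
Proof.
move=> Az; rewrite (eq_dvel oA _ (dpos1_product D k) Az).
have s1 : smooth_on A (fun z => dpos k L1 (p1 z)) by apply: smooth_p1; exact: smooth_dpos.
have s2 : smooth_on A (fun z => dpos k h1 (p1 z)) by apply: smooth_p1; exact: smooth_dpos.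
rewrite (dvelD _ (smooth_onM oA (smooth_h2 D) s1) (smooth_onM oA s2 (smooth_L2 D)) Az).
rewrite (dvelM _ (smooth_h2 D) s1 Az) (dvelM _ s2 (smooth_L2 D) Az).
rewrite !(dvel1_p2 D) !(dvel1_p1 D) (dvel_dpos_warp w1 _ _ Az.1).
by rewrite !mul0r mulr0 !addr0 add0r.
Qed.

Let dvel1_dpos2 j a z : A z ->
  dvel (e1 j) (dpos (e2 a) L) z = dpos a h2 (p2 z) * dvel j L1 (p1 z).
Proof.
move=> Az.
have E y : A y -> dpos (e2 a) L y =
    h1 (p1 y) * dpos a L2 (p2 y) + dpos a h2 (p2 y) * L1 (p1 y).
  by move/swap/(dpos1_product D').
rewrite (eq_dvel oA _ E Az).
have s1 : smooth_on A (fun z => dpos a L2 (p2 z)) by apply: smooth_p2; exact: smooth_dpos.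
have s2 : smooth_on A (fun z => dpos a h2 (p2 z)) by apply: smooth_p2; exact: smooth_dpos.
rewrite (dvelD _ (smooth_onM oA (smooth_h1 D) s1) (smooth_onM oA s2 (smooth_L1 D)) Az).
rewrite (dvelM _ (smooth_h1 D) s1 Az) (dvelM _ s2 (smooth_L1 D) Az).
rewrite !(dvel1_p2 D) !(dvel1_p1 D) (warp_base w1).
by rewrite !mul0r mulr0 !add0r.
Qed.

Let vel1 j (z : phase R N) : z.2 0 (e1 j) = (p1 z).2 0 j.
Proof. by rewrite mxE. Qed.
Let vel2 a (z : phase R N) : z.2 0 (e2 a) = (p2 z).2 0 a.
Proof. by rewrite mxE. Qed.

(** The derivatives along u contribute (df_2^2/du^a v^a) dL1/dy^j, which Euler's relation contracts
    to a multiple of 2 y^i: the 1/2 in [k2] is 1/4 times this 2. The term of dF^2/dx^j containing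
    df_1^2/dx^j gives [q1] and [c2]. *)
Let spray1 i z : A z -> spray L (e1 i) z =
  spray L1 i (p1 z) + k2 (p2 z) * z.2 0 (e1 i) - q1 i (p1 z) * c2 (p2 z).
Proof.
move=> Az; have h2N0 := warp_neq0 w2 Az.2.
rewrite /spray (split_sum D) [X in _ + X]big1 ?addr0 => [|a _]; last first.
  by rewrite (gup12 D) // mul0r.
have E j : \sum_k dvel (e1 j) (dpos k L) z * z.2 0 k - dpos (e1 j) L z =
    h2 (p2 z) * (\sum_k dvel j (dpos k L1) (p1 z) * (p1 z).2 0 k - dpos j L1 (p1 z))
    + (\sum_a dpos a h2 (p2 z) * (p2 z).2 0 a) * dvel j L1 (p1 z)
    - dpos j h1 (p1 z) * L2 (p2 z).
  rewrite (split_sum D) (dpos1_product D) // mulrBr mulr_sumr mulr_suml.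
  under eq_bigr do rewrite dvel1_dpos1 // vel1 -mulrA.
  under [X in _ + X - _]eq_bigr do rewrite dvel1_dpos2 // vel2 mulrAC.
  by rewrite opprD; ring.
under eq_bigr => j _.
  rewrite E (gup11 D) //.
  rewrite (_ : _ * _ =
    gup L1 i j (p1 z) * (\sum_k dvel j (dpos k L1) (p1 z) * (p1 z).2 0 k - dpos j L1 (p1 z))
    + (h2 (p2 z))^-1 * (\sum_a dpos a h2 (p2 z) * (p2 z).2 0 a) *
        (gup L1 i j (p1 z) * dvel j L1 (p1 z))
    - (h2 (p2 z))^-1 * L2 (p2 z) * (gup L1 i j (p1 z) * dpos j h1 (p1 z))); last by field.
  over.
rewrite /= sumrB big_split /= -!mulr_sumr (sum_gup_dvel w1 _ Az.1) vel1.
by rewrite /k2 /c2 /q1; field.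
Qed.

Let smooth_q1 i : smooth_on A1 (q1 i).
Proof.
apply: smooth_on_sum => // j; apply: smooth_onM => //; last exact: smooth_dpos.
by apply: smooth_gup => //; exact: factor_unit w1.
Qed.

Let dvel_q1 i j y : A1 y -> dvel i (q1 j) y = \sum_h dvel i (gup L1 j h) y * dpos h h1 y.
Proof.
move=> Ay; have sg h : smooth_on A1 (gup L1 j h).
  by apply: smooth_gup => //; exact: factor_unit w1.
rewrite (dvel_sum oA1 _ _ Ay) => [|h].
  apply: eq_bigr => h _; rewrite (dvelM _ (sg h) (smooth_dpos _ sh1) Ay).
  by rewrite (dvel_dpos_warp w1) // mulr0 addr0.
by apply: smooth_onM => //; exact: smooth_dpos.
Qed.

Let smooth_hV (c : R) : c != 0 -> smooth_on A2 (fun y => (c * h2 y)^-1).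
Proof.
move=> c0; apply: smooth_onV => //.
  by move=> y Ay; rewrite mulf_neq0 // (warp_neq0 w2).
by apply: smooth_onM => //; exact: smooth_on_cst.
Qed.

(** In the correction to the spray, y^r differentiates to the Kronecker term of M^r_i. In [q1] only
    g^{rh} depends on y, the warping function being a function of x, which gives the other term. *)
Lemma nonlin11 r i z : A z -> nonlin L (e1 r) (e1 i) z = nonlin L1 r i (p1 z) + warpM r i z.
Proof.
move=> Az; rewrite /nonlin (eq_dvel oA _ (@spray1 r) Az).
have s1 : smooth_on A (fun z => spray L1 r (p1 z)).
  by apply: smooth_p1; apply: smooth_spray => //; exact: factor_unit w1.
have s2 : smooth_on A (fun z => k2 (p2 z)).
  apply: smooth_p2; apply: smooth_onM => //; first exact: smooth_hV.
  apply: smooth_on_sum => // a; apply: smooth_onM => //; first exact: smooth_dpos.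
  exact: smooth_vel_coord.
have s3 : smooth_on A (fun z => c2 (p2 z)).
  by apply: smooth_p2; apply: smooth_onM => //; exact: smooth_hV.
have s4 : smooth_on A (fun z => q1 r (p1 z)) by exact: smooth_p1.
have sv := @smooth_vel_coord R N A (e1 r).
have s24 := smooth_onM oA s2 sv; have s34 := smooth_onM oA s4 s3.
rewrite (dvelB _ (smooth_onD oA s1 s24) s34 Az) (dvelD _ s1 s24 Az).
rewrite (dvelM _ s2 sv Az) (dvelM _ s4 s3 Az) !(dvel1_p2 D) !(dvel1_p1 D).
rewrite mul0r mulr0 add0r addr0 dvel_vel_coord (inj_eq (split_inj1 D)).
rewrite (dvel_q1 _ _ Az.1) /warp_nonlin /k2 /c2 -addrA; congr (_ + (_ - _)).
  by congr (_ * _ * _); apply: eq_bigr => a _; rewrite dpos2_p2 vel2.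
rewrite mulrA; congr (_ * _); rewrite mulrC; congr (_ * _).
by apply: eq_bigr => h _; rewrite (dvel1_p1 D) (dpos1_p1 D).
Qed.

(** A function of (x, y) has no derivative in v, so only the pure part G^r_i + M^r_i of the
    nonlinear connection acts on it. *)
Lemma hdelta1_p1 (f : phase R n1 -> R) i z : A z ->
  hdelta L (e1 i) (fun w => f (p1 w)) z = hdelta L1 i f (p1 z)
    - \sum_r warpM r i z * dvel (e1 r) (fun w => f (p1 w)) z.
Proof.
move=> Az; rewrite /hdelta (dpos1_p1 D) (split_sum D) [X in _ - (_ + X)]big1; last first.
  by move=> a _; rewrite dvel2_p1 mulr0.
under eq_bigr do rewrite nonlin11 // (dvel1_p1 D) mulrDl.
under [X in _ = _ - X]eq_bigr do rewrite (dvel1_p1 D).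
by rewrite big_split /= addr0 opprD addrA.
Qed.

Lemma hdelta1_h2 i z : hdelta L (e1 i) (fun w => h2 (p2 w)) z = 0.
Proof.
rewrite /hdelta (dpos1_p2 D) (split_sum D) !big1 ?addr0 ?subr0 // => j _.
  by rewrite (dvel1_h1 D') mulr0.
by rewrite (dvel1_p2 D) mulr0.
Qed.

Lemma hdelta2_p1 (f : phase R n1 -> R) a z :
  hdelta L (e2 a) (fun w => f (p1 w)) z =
    - \sum_r nonlin L (e1 r) (e2 a) z * dvel (e1 r) (fun w => f (p1 w)) z.
Proof.
rewrite /hdelta dpos2_p1 (split_sum D) [X in _ - (_ + X)]big1 ?addr0 ?sub0r // => b _.
by rewrite dvel2_p1 mulr0.
Qed.

Lemma hdelta2_h2 a z : hdelta L (e2 a) (fun w => h2 (p2 w)) z =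
  dpos (e2 a) (fun w => h2 (p2 w)) z.
Proof.
rewrite /hdelta (split_sum D) !big1 ?addr0 ?subr0 // => j _.
  by rewrite (dvel1_h1 D') mulr0.
by rewrite (dvel1_p2 D) mulr0.
Qed.

Let hdelta1_glow i j k z : A z -> hdelta L (e1 i) (glow L (e1 j) (e1 k)) z =
  h2 (p2 z) * (hdelta L1 i (glow L1 j k) (p1 z)
    - \sum_r warpM r i z * dvel (e1 r) (fun w => glow L1 j k (p1 w)) z).
Proof.
move=> Az; rewrite (eq_hdelta oA _ _ (glow11 D j k) Az).
by rewrite (hdeltaM _ _ (smooth_h2 D) (smooth_glow1 D j k) Az) hdelta1_h2 mul0r add0r hdelta1_p1.
Qed.

Let hdelta_glow12 b i a z : A z -> hdelta L b (glow L (e1 i) (e2 a)) z = 0.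
Proof.
move=> Az; rewrite (eq_hdelta oA _ _ (glow12 D i a) Az).
by rewrite /hdelta /dpos derive_cst big1 ?subr0 // => j _; rewrite /dvel derive_cst mulr0.
Qed.

Let hdelta_glow21 b i a z : A z -> hdelta L b (glow L (e2 a) (e1 i)) z = 0.
Proof.
move=> Az; rewrite (eq_hdelta oA _ _ (glow21 D i a) Az).
by rewrite /hdelta /dpos derive_cst big1 ?subr0 // => j _; rewrite /dvel derive_cst mulr0.
Qed.

(** The factor f_2^2 comes out of delta^d/delta^d x^i and cancels against its inverse in g^{kh}; the
    M^r_i subtracted in each of the three derivatives assemble into M^k_ij. *)
Lemma conn111 k i j z : A z ->
  conn L (e1 k) (e1 i) (e1 j) z = conn L1 k i j (p1 z) - warpT k i j z.
Proof.
move=> Az; have h2N0 := warp_neq0 w2 Az.2.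
rewrite /conn /warp_conn -mulrBr -sumrB (split_sum D) [X in _ + X]big1 ?addr0; last first.
  by move=> a _; rewrite (gup12 D) // mul0r.
congr (_ * _); apply: eq_bigr => h _.
rewrite (gup11 D) // !hdelta1_glow // sumrB big_split /=.
by field.
Qed.

Lemma mixed_dglowE j k a z : A z -> warpP j k a z =
  glow L1 j k (p1 z) * dpos (e2 a) (fun w => h2 (p2 w)) z
  - h2 (p2 z) * \sum_r nonlin L (e1 r) (e2 a) z *
      dvel (e1 r) (fun w => glow L1 j k (p1 w)) z.
Proof.
move=> Az; rewrite /mixed_dglow.
rewrite (eq_hdelta oA _ _ (glow11 D j k) Az).
rewrite (hdeltaM _ _ (smooth_h2 D) (smooth_glow1 D j k) Az) hdelta2_h2 hdelta2_p1.
by rewrite mulrN mulrC.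
Qed.

Lemma mixed_dglow_sym j k a z : A z -> warpP j k a z = warpP k j a z.
Proof.
move=> Az; apply: (eq_hdelta oA) => // y Ay.
by rewrite (glow_sym oA (smooth_product D)).
Qed.

(** The other two derivatives fall on mixed entries of the metric, zero on an open set, and
    vanish. *)
Lemma conn112_dglow i l a z : A z -> conn L (e1 i) (e1 l) (e2 a) z =
  (2 * h2 (p2 z))^-1 * \sum_s gup L1 i s (p1 z) * warpP s l a z.
Proof.
move=> Az; have h2N0 := warp_neq0 w2 Az.2.
rewrite /conn (split_sum D) [X in _ + X]big1 ?addr0; last first.
  by move=> b _; rewrite (gup12 D) // mul0r.
rewrite !mulr_sumr; apply: eq_bigr => s _.
rewrite (gup11 D) // !hdelta_glow12 // /mixed_dglow; by field.
Qed.

(** Here the surviving derivative is the subtracted one, whence the sign. *)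
Lemma conn211_dglow a j k z : A z -> conn L (e2 a) (e1 j) (e1 k) z =
  - ((2 * h1 (p1 z))^-1 * \sum_c gup L2 a c (p2 z) * warpP j k c z).
Proof.
move=> Az; have h1N0 := warp_neq0 w1 Az.1.
rewrite /conn (split_sum D) big1 ?add0r; last first.
  by move=> i _; rewrite (gup12 D') ?mul0r //; exact: swap.
rewrite -mulrN -sumrN !mulr_sumr; apply: eq_bigr => c _.
rewrite (gup11 D' _ _ (swap Az)) !hdelta_glow21 // /mixed_dglow; by field.
Qed.

End Connection.

(** * The curvature of the product *)

Lemma eq_alternate (R : realType) n (E F : 'I_n -> 'I_n -> R) k l :
  (forall k l, E k l = F k l) -> alternate E k l = alternate F k l.
Proof. by rewrite /alternate => EF; rewrite !EF. Qed.

Lemma alternate_comp (R : realType) n N (e : 'I_n -> 'I_N) (E : 'I_N -> 'I_N -> R) k l :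
  alternate E (e k) (e l) = alternate (fun k l => E (e k) (e l)) k l.
Proof. by []. Qed.

(** * Mixed coefficients in the form of the statement, and their smoothness *)

Section MixedConnection.
Context {R : realType} {N n1 n2 : nat}.
Context {e1 : 'I_n1 -> 'I_N} {e2 : 'I_n2 -> 'I_N}.
Context {L1 h1 : phase R n1 -> R} {A1 : set (phase R n1)}.
Context {L2 h2 : phase R n2 -> R} {A2 : set (phase R n2)}.
Context {L : phase R N -> R}.
Hypothesis D : doubly_warped e1 e2 L1 h1 A1 L2 h2 A2 L.

Local Notation p1 := (subphase e1).
Local Notation p2 := (subphase e2).
Local Notation A := [set z | A1 (p1 z) /\ A2 (p2 z)].
Local Notation T1 := (warp_conn e1 e2 L1 h1 L2 h2).
Local Notation P1 := (mixed_dglow e1 e2 L).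
Local Notation P2 := (mixed_dglow e2 e1 L).
Local Notation E1 := (mixed_conn12 e1 e2 L1 h2 L).
Local Notation Q1 := (mixed_conn22 e1 e2 L1 h1 L2 L).

Let D' := doubly_warped_sym D.
Let w1 := factor1 D.
Let w2 := factor2 D.
Let oA := open_dom D.
Let sL := smooth_product D.
Let uL := product_unit D.

Let swap z : A z -> [set z | A2 (p2 z) /\ A1 (p1 z)] z.
Proof. by case. Qed.

Let smooth_connL a b c : smooth_on A (conn L a b c).
Proof. by apply: smooth_conn => //; exact: uL. Qed.

Let smooth_conn1 i j k : smooth_on A (fun z => conn L1 i j k (p1 z)).
Proof.
apply: smooth_p1; apply: (smooth_conn (factor_open w1)).
  exact: factor_smooth w1.
exact: factor_unit w1.
Qed.

(** The Kronecker symbol in the bracket is g^{is} g_sk. *)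
Lemma mixed_conn12E i k a z : A z ->
  E1 i k a z = \sum_s gup L1 i s (p1 z) * P1 s k a z.
Proof.
move=> Az; under eq_bigr do rewrite (mixed_dglowE D) // mulrBr mulrA.
rewrite sumrB -mulr_suml (sum_gup_glow (factor_unit w1) _ _ Az.1) /mixed_conn12.
rewrite mulrC; congr (_ - _); rewrite exchange_big mulr_sumr; apply: eq_bigr => s _.
rewrite mulrCA; congr (_ * _); rewrite mulr_sumr; apply: eq_bigr => r _.
by rewrite -mulrA mulrCA.
Qed.

Lemma mixed_conn22E i a b z : A z ->
  Q1 i a b z = \sum_s gup L1 i s (p1 z) * P2 a b s z.
Proof.
move=> Az.
under eq_bigr => s _ do rewrite (mixed_dglowE D' _ _ _ (swap Az)) mulrBr.
rewrite sumrB /mixed_conn22; congr (_ - _).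
  by apply: eq_bigr => s _; rewrite mulrC mulrA mulrC mulrA; ring.
rewrite exchange_big mulr_sumr; apply: eq_bigr => s _.
rewrite mulrCA; congr (_ * _); rewrite mulr_sumr; apply: eq_bigr => r _.
by rewrite -mulrA mulrCA.
Qed.

Lemma mixed_conn12TE i k a z : A z ->
  mixed_conn12T e1 e2 L1 h2 L i k a z = E1 i k a z.
Proof.
move=> Az; congr (_ - _ * _); apply: eq_bigr => r _; apply: eq_bigr => h _.
congr (_ * _); apply: (eq_dvel oA) Az => y Ay.
exact: (glow_sym (factor_open w1) (factor_smooth w1)) Ay.1.
Qed.

Lemma conn112 i k a z : A z ->
  conn L (e1 i) (e1 k) (e2 a) z = (2 * h2 (p2 z))^-1 * E1 i k a z.
Proof. by move=> Az; rewrite (conn112_dglow D) // mixed_conn12E. Qed.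

Lemma conn121 i k a z : A z ->
  conn L (e1 i) (e2 a) (e1 k) z = (2 * h2 (p2 z))^-1 * E1 i k a z.
Proof. by move=> Az; rewrite (conn_sym oA) // conn112. Qed.

Lemma conn122 i a b z : A z ->
  conn L (e1 i) (e2 a) (e2 b) z = - ((2 * h2 (p2 z))^-1 * Q1 i a b z).
Proof. by move=> Az; rewrite (conn211_dglow D' _ _ _ (swap Az)) mixed_conn22E. Qed.

Lemma mixed_conn22_sym i a b z : A z -> Q1 i a b z = Q1 i b a z.
Proof.
move=> Az; rewrite !mixed_conn22E //; apply: eq_bigr => s _.
by rewrite (mixed_dglow_sym D' _ _ _ (swap Az)).
Qed.

(** Read backwards, [conn111] exhibits M^i_jk as a difference of two connection coefficients already
    known to be smooth; the two brackets below are likewise recovered from mixed coefficients. *)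
Lemma smooth_warp_conn i j k : smooth_on A (T1 i j k).
Proof.
apply: (@eq_smooth_on _ _ _ (fun z => conn L1 i j k (p1 z) - conn L (e1 i) (e1 j) (e1 k) z)) => //.
  by move=> z Az; rewrite (conn111 D) //; ring.
exact: smooth_onB.
Qed.

Let neq0_2h2 z : A z -> 2 * h2 (p2 z) != 0.
Proof. by move=> Az; rewrite mulf_neq0 // (warp_neq0 w2 Az.2). Qed.

Let smooth_2h2 : smooth_on A (fun z => 2 * h2 (p2 z)).
Proof. by apply: smooth_onM (smooth_h2 D) => //; exact: smooth_on_cst. Qed.

Lemma smooth_mixed_conn12 i k a : smooth_on A (E1 i k a).
Proof.
apply: (@eq_smooth_on _ _ _ (fun z => (2 * h2 (p2 z)) * conn L (e1 i) (e1 k) (e2 a) z)) => //.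
  by move=> z Az; rewrite conn112 // mulrA divff ?mul1r // neq0_2h2.
exact: smooth_onM.
Qed.

Lemma smooth_mixed_conn22 i a b : smooth_on A (Q1 i a b).
Proof.
apply: (@eq_smooth_on _ _ _ (fun z => - ((2 * h2 (p2 z)) * conn L (e1 i) (e2 a) (e2 b) z))) => //.
  by move=> z Az; rewrite conn122 // mulrN opprK mulrA divff ?mul1r // neq0_2h2.
by apply: smooth_onN => //; exact: smooth_onM.
Qed.

(** This is why the statement writes 1/(2 f_2^2) in front of delta^d/delta^d x^l but leaves it under
    delta^d/delta^d u^b, which does differentiate f_2. *)
Lemma hdelta1_scale i f z : smooth_on A f -> A z ->
  hdelta L (e1 i) (fun w => (2 * h2 (p2 w))^-1 * f w) z =
  (2 * h2 (p2 z))^-1 * hdelta L (e1 i) f z.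
Proof.
move=> sf Az.
have sV : smooth_on A (fun w => (2 * h2 (p2 w))^-1).
  by apply: smooth_onV => //; exact: neq0_2h2.
rewrite (hdeltaM _ _ sV sf Az) (hdeltaV oA smooth_2h2 neq0_2h2 Az) ?mul0r ?add0r //.
by rewrite (hdeltaZ _ _ _ (smooth_h2 D) Az) (hdelta1_h2 D) mulr0.
Qed.

End MixedConnection.

(** * Components with upper index in the first factor *)

Section Curvature.
Context {R : realType} {N n1 n2 : nat}.
Context {e1 : 'I_n1 -> 'I_N} {e2 : 'I_n2 -> 'I_N}.
Context {L1 h1 : phase R n1 -> R} {A1 : set (phase R n1)}.
Context {L2 h2 : phase R n2 -> R} {A2 : set (phase R n2)}.
Context {L : phase R N -> R}.
Hypothesis D : doubly_warped e1 e2 L1 h1 A1 L2 h2 A2 L.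

Local Notation p1 := (subphase e1).
Local Notation p2 := (subphase e2).
Local Notation A := [set z | A1 (p1 z) /\ A2 (p2 z)].
Local Notation M1 := (warp_nonlin e1 e2 L1 h1 L2 h2).
Local Notation T1 := (warp_conn e1 e2 L1 h1 L2 h2).
Local Notation T2 := (warp_conn e2 e1 L2 h2 L1 h1).
Local Notation P1 := (mixed_dglow e1 e2 L).
Local Notation E1 := (mixed_conn12 e1 e2 L1 h2 L).
Local Notation E2 := (mixed_conn12 e2 e1 L2 h1 L).
Local Notation E2T := (mixed_conn12T e2 e1 L2 h1 L).
Local Notation Q1 := (mixed_conn22 e1 e2 L1 h1 L2 L).

Let D' := doubly_warped_sym D.
Let w1 := factor1 D.
Let w2 := factor2 D.
Let oA := open_dom D.
Let sL := smooth_product D.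
Let uL := product_unit D.

Let swap z : A z -> [set z | A2 (p2 z) /\ A1 (p1 z)] z.
Proof. by case. Qed.

Let smooth_conn1 i j k : smooth_on A (fun z => conn L1 i j k (p1 z)).
Proof.
apply: smooth_p1; apply: (smooth_conn (factor_open w1)).
  exact: factor_smooth w1.
exact: factor_unit w1.
Qed.

(** The curvature is a bracket minus its transpose in the last two indices. With the contracted
    index split inside the bracket, an alternated formula follows from an equality of brackets. *)
Let riem_alt a b c d z : riem L b a c d z = alternate (fun c d =>
  hdelta L d (conn L a b c) z + \sum_r conn L a d (e1 r) z * conn L (e1 r) b c z
  + \sum_m conn L a d (e2 m) z * conn L (e2 m) b c z) c d.
Proof.
have E (x y s t s' t' : R) : x - y + (s + t) - (s' + t') =
  (x + s + t) - (y + s' + t') by ring.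
by rewrite /riem /alternate !(split_sum D) E.
Qed.

Lemma riem1111 j i k l z : A z -> riem L (e1 j) (e1 i) (e1 k) (e1 l) z =
  riem L1 j i k l (p1 z) - alternate (fun k l : 'I_n1 =>
      \sum_r M1 r l z * dvel (e1 r) (fun w => conn L1 i j k (p1 w)) z
      + hdelta L (e1 l) (T1 i j k) z
      + \sum_h conn L1 i l h (p1 z) * T1 h j k z
      + \sum_h T1 i l h z * conn L1 h j k (p1 z)
      - \sum_h T1 i l h z * T1 h j k z
      + (4 * h1 (p1 z) * h2 (p2 z))^-1 * \sum_s \sum_a \sum_c
          gup L1 i s (p1 z) * gup L2 a c (p2 z) * P1 s l c z * P1 j k a z) k l.
Proof.
move=> Az; have [h1N0 h2N0] := (warp_neq0 w1 Az.1, warp_neq0 w2 Az.2).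
rewrite riem_alt (alternate_comp e1).
(* The bracket whose alternation is the curvature of the first factor; the brackets agree even
   before alternation. *)
pose B1 k l := hdelta L1 l (conn L1 i j k) (p1 z)
  + \sum_h conn L1 i l h (p1 z) * conn L1 h j k (p1 z).
set F := (X in _ = _ - alternate X k l).
have -> : riem L1 j i k l (p1 z) = alternate B1 k l.
  have E (x y s t : R) : x - y + s - t = x + s - (y + t) by ring.
  by rewrite /riem /alternate /B1 E.
transitivity (alternate (fun k l => B1 k l - F k l) k l); last first.
  have E (x y s t : R) : x - y - (s - t) = x - s - (y - t) by ring.
  by rewrite /alternate E.
apply: eq_alternate => {}k {}l.
rewrite (eq_hdelta oA _ _ (conn111 D i j k) Az).
rewrite (hdeltaB _ _ (smooth_conn1 _ _ _) (smooth_warp_conn D _ _ _) Az) (hdelta1_p1 D) //.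
have -> : \sum_r conn L (e1 i) (e1 l) (e1 r) z * conn L (e1 r) (e1 j) (e1 k) z =
    \sum_h conn L1 i l h (p1 z) * conn L1 h j k (p1 z)
    - \sum_h conn L1 i l h (p1 z) * T1 h j k z
    - \sum_h T1 i l h z * conn L1 h j k (p1 z) + \sum_h T1 i l h z * T1 h j k z.
  rewrite -!sumrB -big_split /=; apply: eq_bigr => r _.
  by rewrite !(conn111 D) // mulrBl !mulrBr opprB addrA addrAC.
have -> : \sum_m conn L (e1 i) (e1 l) (e2 m) z * conn L (e2 m) (e1 j) (e1 k) z =
    - ((4 * h1 (p1 z) * h2 (p2 z))^-1 * \sum_s \sum_a \sum_c
          gup L1 i s (p1 z) * gup L2 a c (p2 z) * P1 s l c z * P1 j k a z).
  under eq_bigr => m _.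
    rewrite (conn112_dglow D) // (conn211_dglow D) //.
    rewrite (_ : _ * _ = - ((4 * h1 (p1 z) * h2 (p2 z))^-1 *
      ((\sum_s gup L1 i s (p1 z) * P1 s l m z) * (\sum_a gup L2 m a (p2 z) * P1 j k a z))));
      last by field; exact/andP.
    over.
  rewrite /= sumrN -mulr_sumr; congr (- (_ * _)).
  under [LHS]eq_bigr do rewrite mulr_suml.
  rewrite exchange_big; apply: eq_bigr => s _ /=.
  rewrite [RHS]exchange_big; apply: eq_bigr => c _ /=.
  rewrite mulr_sumr; apply: eq_bigr => a _.
  (* The two contracted Greek indices occur in opposite orders in the inverse metric. *)
  by rewrite (gup_sym (factor_open w2) (factor_smooth w2) _ _ Az.2); ring.
have E (a b c d e f g q : R) :
  a - b - c + (d - e - f + g) + - q = a + d - (b + c + e + f - g + q) by ring.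
by rewrite E.
Qed.

Lemma riem2111 i k l a z : A z -> riem L (e2 a) (e1 i) (e1 k) (e1 l) z =
  alternate (fun k l : 'I_n1 =>
    (2 * h2 (p2 z))^-1 * hdelta L (e1 l) (E1 i k a) z
    + (2 * h2 (p2 z))^-1 * \sum_r (conn L1 i r l (p1 z) - T1 i r l z) * E1 r k a z
    + (4 * h1 (p1 z) * h2 (p2 z))^-1 * \sum_b E1 i l b z * E2T b a k z) k l.
Proof.
move=> Az; have [h1N0 h2N0] := (warp_neq0 w1 Az.1, warp_neq0 w2 Az.2).
rewrite riem_alt (alternate_comp e1).
apply: eq_alternate => {}k {}l; congr (_ + _ + _).
- rewrite (eq_hdelta oA _ _ (conn121 D i k a) Az) (hdelta1_scale D) //.
  exact: (smooth_mixed_conn12 D).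
- rewrite mulr_sumr; apply: eq_bigr => r _.
  by rewrite (conn_sym oA) // (conn111 D) // (conn121 D) // mulrCA.
- rewrite mulr_sumr; apply: eq_bigr => b _.
  rewrite (conn112 D) // (conn112 D' _ _ _ (swap Az)) (mixed_conn12TE D' _ _ _ (swap Az)).
  by field; exact/andP.
Qed.
Lemma riem1122 i j b c z : A z -> riem L (e1 j) (e1 i) (e2 b) (e2 c) z =
  alternate (fun b c : 'I_n2 =>
    hdelta L (e2 c) (fun w => (2 * h2 (p2 w))^-1 * E1 i j b w) z
    + (4 * h2 (p2 z) ^+ 2)^-1 * \sum_r E1 i r c z * E1 r j b z
    - (4 * h1 (p1 z) * h2 (p2 z))^-1 * \sum_a Q1 i a c z * E2T a b j z) b c.
Proof.
move=> Az; have [h1N0 h2N0] := (warp_neq0 w1 Az.1, warp_neq0 w2 Az.2).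
rewrite riem_alt (alternate_comp e2).
apply: eq_alternate => {}b {}c; congr (_ + _ + _).
- exact: (eq_hdelta oA _ _ (conn112 D i j b) Az).
- rewrite mulr_sumr; apply: eq_bigr => r _.
  by rewrite (conn121 D) // (conn112 D) //; field.
- rewrite -mulrN -sumrN mulr_sumr; apply: eq_bigr => a _.
  rewrite (conn_sym oA) // (conn122 D) // (conn121 D' _ _ _ (swap Az)).
  rewrite (mixed_conn12TE D' _ _ _ (swap Az)); by field; exact/andP.
Qed.

(** The last two indices belong to different factors, so no alternation survives and the two halves
    of the curvature are expanded separately. *)
Lemma riem2121 i l a b z : A z -> riem L (e2 a) (e1 i) (e2 b) (e1 l) z =
  - hdelta L (e2 b) (fun w => (2 * h2 (p2 w))^-1 * E1 i l a w) z
  - (2 * h2 (p2 z))^-1 * hdelta L (e1 l) (Q1 i a b) z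
  - (4 * h2 (p2 z) ^+ 2)^-1 * (\sum_r E1 i r b z * E1 r l a z)
  + (4 * h1 (p1 z) * h2 (p2 z))^-1 * (\sum_c Q1 i c b z * E2 c a l z)
  - (2 * h2 (p2 z))^-1 * (\sum_r (conn L1 i r l (p1 z) - T1 i r l z) * Q1 r a b z)
  + (2 * h2 (p2 z))^-1 *
      (\sum_c E1 i l c z * (conn L2 c a b (p2 z) - T2 c a b z)).
Proof.
move=> Az; have [h1N0 h2N0] := (warp_neq0 w1 Az.1, warp_neq0 w2 Az.2).
rewrite /riem !(split_sum D) /=.
rewrite (eq_hdelta oA _ _ (conn121 D i l a) Az).
have -> : hdelta L (e1 l) (conn L (e1 i) (e2 a) (e2 b)) z =
    - ((2 * h2 (p2 z))^-1 * hdelta L (e1 l) (Q1 i a b) z).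
  (* The sign is written as a scalar -1 inside, so that [hdelta1_scale] and then [hdeltaZ] take both
     constants out. *)
  have E y : A y -> conn L (e1 i) (e2 a) (e2 b) y = (2 * h2 (p2 y))^-1 * (-1 * Q1 i a b y).
    by move=> Ay; rewrite (conn122 D) // mulN1r mulrN.
  have sQ := smooth_mixed_conn22 D i a b.
  rewrite (eq_hdelta oA _ _ E Az) (hdelta1_scale D _ _ Az); last first.
    by apply: smooth_onM => //; exact: smooth_on_cst.
  by rewrite (hdeltaZ _ _ _ sQ Az) mulN1r mulrN.
have -> : \sum_r conn L (e1 i) (e1 l) (e1 r) z * conn L (e1 r) (e2 a) (e2 b) z =
   - ((2 * h2 (p2 z))^-1 * (\sum_r (conn L1 i r l (p1 z) - T1 i r l z) * Q1 r a b z)).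
  rewrite -mulrN -sumrN mulr_sumr; apply: eq_bigr => r _.
  by rewrite (conn_sym oA) // (conn111 D) // (conn122 D) //; ring.
have -> : \sum_c conn L (e1 i) (e1 l) (e2 c) z * conn L (e2 c) (e2 a) (e2 b) z =
    (2 * h2 (p2 z))^-1 *
      (\sum_c E1 i l c z * (conn L2 c a b (p2 z) - T2 c a b z)).
  rewrite mulr_sumr; apply: eq_bigr => c _.
  by rewrite (conn112 D) // (conn111 D' _ _ _ (swap Az)) mulrA.
have -> : \sum_r conn L (e1 i) (e2 b) (e1 r) z * conn L (e1 r) (e2 a) (e1 l) z =
    (4 * h2 (p2 z) ^+ 2)^-1 * (\sum_r E1 i r b z * E1 r l a z).
  rewrite mulr_sumr; apply: eq_bigr => r _.
  by rewrite !(conn121 D) //; field.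
have -> : \sum_c conn L (e1 i) (e2 b) (e2 c) z * conn L (e2 c) (e2 a) (e1 l) z =
    - ((4 * h1 (p1 z) * h2 (p2 z))^-1 * (\sum_c Q1 i c b z * E2 c a l z)).
  rewrite -mulrN -sumrN mulr_sumr; apply: eq_bigr => c _.
  rewrite (conn_sym oA) // (conn122 D) // (conn112 D' _ _ _ (swap Az)).
  by field; exact/andP.
by ring.
Qed.
End Curvature.

(** * Components with upper index in the second factor, by exchange *)

Section SwappedCurvature.
Context {R : realType} {N n1 n2 : nat}.
Context {e1 : 'I_n1 -> 'I_N} {e2 : 'I_n2 -> 'I_N}.
Context {L1 h1 : phase R n1 -> R} {A1 : set (phase R n1)}.
Context {L2 h2 : phase R n2 -> R} {A2 : set (phase R n2)}.
Context {L : phase R N -> R}.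
Hypothesis D : doubly_warped e1 e2 L1 h1 A1 L2 h2 A2 L.

Local Notation p1 := (subphase e1).
Local Notation p2 := (subphase e2).
Local Notation A := [set z | A1 (p1 z) /\ A2 (p2 z)].
Local Notation M2 := (warp_nonlin e2 e1 L2 h2 L1 h1).
Local Notation T2 := (warp_conn e2 e1 L2 h2 L1 h1).
Local Notation P1 := (mixed_dglow e1 e2 L).
Local Notation P2 := (mixed_dglow e2 e1 L).
Local Notation E1 := (mixed_conn12 e1 e2 L1 h2 L).
Local Notation E2T := (mixed_conn12T e2 e1 L2 h1 L).

Let D' := doubly_warped_sym D.
Let oA := open_dom D.

Let swap z : A z -> [set z | A2 (p2 z) /\ A1 (p1 z)] z.
Proof. by case. Qed.

(** The exchange puts the transposed metric on the Latin brackets, whereas the statement has it on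
    the Greek ones; symmetry of both metrics reconciles the two forms. *)
Lemma riem1222 j c a b z : A z -> riem L (e1 j) (e2 c) (e2 a) (e2 b) z =
  alternate (fun a b : 'I_n2 =>
    (2 * h1 (p1 z))^-1 * hdelta L (e2 b) (E2T c a j) z
    + (2 * h1 (p1 z))^-1 * \sum_m (conn L2 c m b (p2 z) - T2 c m b z) * E2T m a j z
    + (4 * h1 (p1 z) * h2 (p2 z))^-1 * \sum_r E2T c b r z * E1 r j a z) a b.
Proof.
move=> Az; have Az' := swap Az; rewrite (riem2111 D' _ _ _ _ Az') (mulrAC 4).
apply: eq_alternate => {}a {}b.
have congr3 (p q s x y u x' y' u' : R) : x = x' -> y = y' -> u = u' ->
  p * x + q * y + s * u = p * x' + q * y' + s * u' by move=> -> -> ->.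
apply: congr3.
- apply: (eq_hdelta oA) Az => y Ay.
  by rewrite (mixed_conn12TE D' _ _ _ (swap Ay)).
- by apply: eq_bigr => m _; rewrite (mixed_conn12TE D' _ _ _ Az').
- apply: eq_bigr => r _.
  by rewrite (mixed_conn12TE D' _ _ _ Az') (mixed_conn12TE D _ _ _ Az).
Qed.

(** In its last term the statement pulls g^{γλ} out of the bracket, so the exchanged [mixed_conn22]
    is reopened as a contraction of [mixed_dglow]. *)
Lemma riem2211 c a k l z : A z -> riem L (e2 a) (e2 c) (e1 k) (e1 l) z =
  alternate (fun k l : 'I_n1 =>
    hdelta L (e1 l) (fun w => (2 * h1 (p1 w))^-1 * E2T c a k w) z
    + (4 * h1 (p1 z) ^+ 2)^-1 * \sum_b E2T c b l z * E2T b a k z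
    - (4 * h1 (p1 z) * h2 (p2 z))^-1 * \sum_m \sum_r
        gup L2 c m (p2 z) * P1 l r m z * E1 r k a z) k l.
Proof.
move=> Az; have Az' := swap Az; rewrite (riem1122 D' _ _ _ _ Az') (mulrAC 4).
apply: eq_alternate => {}k {}l.
have congr3 (q s x y u x' y' u' : R) : x = x' -> y = y' -> u = u' ->
  x + q * y - s * u = x' + q * y' - s * u' by move=> -> -> ->.
apply: congr3.
- apply: (eq_hdelta oA) Az => y Ay.
  by rewrite (mixed_conn12TE D' _ _ _ (swap Ay)).
- by apply: eq_bigr => b _; rewrite !(mixed_conn12TE D' _ _ _ Az').
- rewrite [RHS]exchange_big; apply: eq_bigr => r _.
  rewrite (mixed_conn22_sym D' _ _ _ Az') (mixed_conn22E D' _ _ _ Az') mulr_suml.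
  by rewrite (mixed_conn12TE D _ _ _ Az).
Qed.

Lemma riem2222 a c b d z : A z -> riem L (e2 a) (e2 c) (e2 b) (e2 d) z =
  riem L2 a c b d (p2 z) - alternate (fun b d : 'I_n2 =>
      \sum_m M2 m d z * dvel (e2 m) (fun w => conn L2 c a b (p2 w)) z
      + hdelta L (e2 d) (T2 c a b) z
      + \sum_m conn L2 c d m (p2 z) * T2 m a b z
      + \sum_m T2 c d m z * (conn L2 m a b (p2 z) - T2 m a b z)
      + (4 * h1 (p1 z) * h2 (p2 z))^-1 * \sum_n \sum_r \sum_s
          gup L2 c n (p2 z) * gup L1 r s (p1 z) * P2 n d s z * P2 a b r z) b d.
Proof.
move=> Az; rewrite (riem1111 D' _ _ _ _ (swap Az)) (mulrAC 4); congr (_ - _).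
apply: eq_alternate => {}b {}d; congr (_ + _ * _).
(* The terms M F and - M M, kept apart on the Latin side, are gathered as M (F - M). *)
rewrite -addrA -sumrB; congr (_ + _); apply: eq_bigr => m _.
by rewrite mulrBr.
Qed.
End SwappedCurvature.

(** * Finsler metrics read in a chart *)

Section FibreScaling.
Context {R : realType} {n : nat}.

Definition fibre_scale (a : R) (z : phase R n) : phase R n := (z.1, a *: z.2).

Let fibre_scale_linear a : linear (fibre_scale a).
Proof.
move=> c u v; rewrite /fibre_scale [RHS]surjective_pairing; congr (_, _) => //=.
by rewrite scalerDr !scalerA mulrC.
Qed.

HB.instance Definition _ a :=
  GRing.isLinear.Build R (phase R n) (phase R n) _ (fibre_scale a) (fibre_scale_linear a).

(** Differentiating L(x, a y) = a^2 L(x, y) in y^i and cancelling one a shows that dL/dy^i is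
    1-homogeneous. Its difference quotient along the ray through y is then constant, equal to its
    value. *)
Lemma euler_dvel (L : phase R n -> R) (X : set 'rV[R]_n) i z :
  let A := [set z : phase R n | X z.1 /\ z.2 != 0] in
  smooth_on A L ->
  (forall a z, 0 < a -> L (fibre_scale a z) = a ^+ 2 * L z) ->
  A z -> \sum_k dvel k (dvel i L) z * z.2 0 k = dvel i L z.
Proof.
move=> A sL hL Az.
have dL v y : A y -> differentiable (iter_derive v L) y by exact: sL.
have hg a : 0 < a -> dvel i L (fibre_scale a z) = a * dvel i L z.
  move=> a0; have aN0 : a != 0 by rewrite gt_eqF.
  have Aaz : A (fibre_scale a z).
    by split; [exact: Az.1|rewrite scaler_eq0 negb_or aN0; exact: Az.2].
  have := congr1 (@^~ z) (derive_lin_comp (fibre_scale a) L (0, delta_mx 0 i)).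
  have -> : 'D_(0, delta_mx 0 i) (L \o fibre_scale a) z = a ^+ 2 * dvel i L z.
    have -> : L \o fibre_scale a = (a ^+ 2) *: L.
      by apply/funext => y; rewrite /= hL.
    by rewrite deriveZ //; apply: diff_derivable; exact: (dL [::]).
  rewrite /=.
  have -> : fibre_scale a (0, delta_mx 0 i) = a *: ((0, delta_mx 0 i) : phase R n).
    by rewrite /fibre_scale /=; congr (_, _); rewrite scaler0.
  rewrite deriveE; last exact: (dL [::]).
  rewrite linearZ /= -deriveE; last exact: (dL [::]).
  by rewrite expr2 -mulrA => /(mulfI aN0).
have dg : differentiable (dvel i L) z by exact: (dL [:: (0, delta_mx 0 i)]).
have -> : \sum_k dvel k (dvel i L) z * z.2 0 k = 'D_(0, z.2) (dvel i L) z.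
  have -> : ((0, z.2) : phase R n) = \sum_k z.2 0 k *: ((0, delta_mx 0 k) : phase R n).
    rewrite [LHS]surjective_pairing [RHS]surjective_pairing; congr (_, _) => /=.
      by rewrite (raddf_sum fst) big1 // => k _ /=; rewrite scaler0.
    rewrite [LHS]row_sum_delta (raddf_sum snd) /=.
    by apply: eq_bigr.
  rewrite deriveE // linear_sum; apply: eq_bigr => k _.
  by rewrite linearZ /= -deriveE // mulrC.
rewrite /derive; apply: cvg_lim => //.
apply: (@cvg_trans _ ((fun=> dvel i L z) @ 0^' : set_system R)); last exact: cvg_cst.
apply: near_eq_cvg; near=> t.
(* Homogeneity is available for positive factors only, and the factor here is 1 + t. *)
have t1 : `|t| < 1 by near: t; exact: dnbhs0_lt.
have tN0 : t != 0 by near: t; exact: nbhs_dnbhs_neq.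
have t0 : 0 < 1 + t by move: t1; rewrite ltr_norml => /andP[? _]; rewrite -ltrBlDl sub0r.
rewrite /=.
have -> : t *: ((0, z.2) : phase R n) + z = fibre_scale (1 + t) z.
  rewrite /fibre_scale [LHS]surjective_pairing; congr (_, _) => /=.
    by rewrite scaler0 add0r.
  by rewrite scalerDl scale1r addrC.
by rewrite hg // mulrDl mul1r addrC addKr [RHS]mulrA mulVf // mul1r.
Unshelve. all: by end_near. Qed.
End FibreScaling.

(** * From Finsler metrics on manifolds to warped factors *)

Section FinslerFactor.
Context {R : realType} {n : nat} {M : manifold R n}.
Implicit Types (F : finsler M) (c : chart R n M).

Lemma tangent_ext (X Y : tangent M) : tbase X = tbase Y -> tact X = tact Y -> X = Y.
Proof.
case: X Y => [bX aX ? ? ? ?] [bY aY ? ? ? ?] /= bE aE.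
by subst; congr Tangent; exact: Prop_irrelevance.
Qed.

(** Carries homogeneity of the norm over to coordinates: a directional derivative at a
    differentiable point is linear in the direction, and in the default branch both actions are
    0. *)
Lemma tcoordZ c (x y : 'rV[R]_n) a : tcoord c x (a *: y) = tscale a (tcoord c x y).
Proof.
apply: tangent_ext => //; apply/funext => f /=.
case: asboolP => [[ac [cx sf]]|_]; last by rewrite mulr0.
have df : differentiable (f \o chart_inv c) x by exact: (sf c ac [::]).
by rewrite deriveE // linearZ /= -deriveE.
Qed.

Lemma fst_continuous : continuous (fst : phase R n -> 'rV[R]_n).
Proof. by move=> z; exact: cvg_fst. Qed.

Lemma open_slit c : open (slit c).
Proof.
apply: openI.
  apply: (@open_comp _ _ (fst : phase R n -> 'rV[R]_n) (chart_img c)) (@chart_img_open _ _ _ c).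
  by move=> z _; exact: fst_continuous.
suff : open ((fun z : phase R n => `|z.2|) @^-1` [set r | 0 < r]).
  by congr open; apply/seteqP; split => z /=; rewrite normr_gt0.
apply: open_comp (@open_gt R 0) => z _.
apply: (@continuous_comp _ _ _ (snd : phase R n -> 'rV[R]_n) Num.norm).
  exact: cvg_snd.
exact: norm_continuous.
Qed.

Lemma finsler_factor F f c : smooth_fun f -> (forall p, 0 < f p) -> atlas c ->
  warped_factor (fun z => in_coord c F z ^+ 2)
                (fun z : phase R n => f (chart_inv c z.1) ^+ 2) (slit c).
Proof.
move=> sf f0 ac; have oA := @open_slit c.
have sL : smooth_on (slit c) (fun z => in_coord c F z ^+ 2).
  exact: smooth_onM oA (fnorm_smooth F ac) (fnorm_smooth F ac).
split=> //.
(* A nonzero w in the kernel of g_ij would make g_ij w^i w^j zero, against strong convexity. *)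
- move=> z Az; rewrite -row_free_unit; apply: inj_row_free => w wg.
  apply/eqP/negPn/negP => wN0; have := fnorm_convex F ac Az wN0.
  rewrite exchange_big big1 ?ltxx // => j _; rewrite -mulr_suml.
  have /rowP/(_ j) := wg; rewrite !mxE => wgj.
  rewrite (_ : \sum_i _ = 0) ?mul0r // -[RHS]wgj.
  by apply: eq_bigr => i _; rewrite mulrC.
- move=> i z Az; apply: (@euler_dvel _ _ _ (chart_img c) i z sL) Az => a y a0.
  by rewrite /in_coord /= tcoordZ fnorm_homogeneous // exprMn.
- move=> s z [Az _].
  have sff := smooth_onM (@chart_img_open _ _ _ c) (sf c ac) (sf c ac).
  exact: (smooth_on_comp (p := fst) fst_continuous sff).
- by move=> z _; rewrite expf_neq0 // gt_eqF.
- move=> i z; rewrite /dvel.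
  have := derive_lin_comp (fst : {linear phase R n -> 'rV[R]_n})
    (fun x => f (chart_inv c x) ^+ 2) (0, delta_mx 0 i).
  by move/(congr1 (@^~ z)) => ->; rewrite /= derive0.
Qed.
End FinslerFactor.

Lemma doubly_warped_finsler (R : realType) (n1 n2 : nat)
    (M1 : manifold R n1) (M2 : manifold R n2) (F1 : finsler M1) (F2 : finsler M2)
    (f1 : M1 -> R) (f2 : M2 -> R) (c1 : chart R n1 M1) (c2 : chart R n2 M2) :
  smooth_fun f1 -> smooth_fun f2 -> (forall p, 0 < f1 p) -> (forall q, 0 < f2 q) ->
  atlas c1 -> atlas c2 ->
  doubly_warped (@lshift n1 n2) (@rshift n1 n2)
    (fun z => in_coord c1 F1 z ^+ 2) (fun z => f1 (chart_inv c1 z.1) ^+ 2) (slit c1)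
    (fun z => in_coord c2 F2 z ^+ 2) (fun z => f2 (chart_inv c2 z.1) ^+ 2) (slit c2)
    (fun z : phase R (n1 + n2) => dwp_norm F1 F2 f1 f2
       (tcoord c1 (subphase (@lshift n1 n2) z).1 (subphase (@lshift n1 n2) z).2,
        tcoord c2 (subphase (@rshift n1 n2) z).1 (subphase (@rshift n1 n2) z).2) ^+ 2).
Proof.
move=> sf1 sf2 f10 f20 a1 a2; split.
- exact: lshift_inj.
- exact: rshift_inj.
- by move=> i a; rewrite eq_lrshift.
- by move=> F; rewrite big_split_ord.
- by move=> b; case: (split_ordP b) => j ->; [left|right]; exists j.
- exact: finsler_factor.
- exact: finsler_factor.
- apply/funext => z; rewrite sqr_sqrtr //.
  by rewrite addr_ge0 // mulr_ge0 // sqr_ge0.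
Qed.

Theorem lemma5 (R : realType) (n1 n2 : nat)
    (M1 : manifold R n1) (M2 : manifold R n2)
    (F1 : finsler M1) (F2 : finsler M2)
    (f1 : M1 -> R) (f2 : M2 -> R)
    (f1_smooth : smooth_fun f1) (f2_smooth : smooth_fun f2)
    (f1_gt0 : forall p, 0 < f1 p) (f2_gt0 : forall q, 0 < f2 q)
    (c1 : chart R n1 M1) (c2 : chart R n2 M2)
    (c1_atlas : atlas c1) (c2_atlas : atlas c2) :
  let P := phase R (n1 + n2) in
  (* Latin and Greek components of an index of the product *)
  let lat : 'I_n1 -> 'I_(n1 + n2) := fun i => lshift n2 i in
  let grk : 'I_n2 -> 'I_(n1 + n2) := fun a => rshift n1 a in
  (* squares of F, F_1, F_2, f_1, f_2 in local coordinates *)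
  let L : P -> R := fun z =>
    dwp_norm F1 F2 f1 f2 (tcoord c1 (phase1 z).1 (phase1 z).2,
                          tcoord c2 (phase2 z).1 (phase2 z).2) ^+ 2 in
  let L1 : phase R n1 -> R := fun z => in_coord c1 F1 z ^+ 2 in
  let L2 : phase R n2 -> R := fun z => in_coord c2 F2 z ^+ 2 in
  let FF1 : P -> R := fun z => L1 (phase1 z) in
  let FF2 : P -> R := fun z => L2 (phase2 z) in
  let ff1 : P -> R := fun z => f1 (chart_inv c1 (phase1 z).1) ^+ 2 in
  let ff2 : P -> R := fun z => f2 (chart_inv c2 (phase2 z).1) ^+ 2 in
  (* d/dx^i, d/du^a, d/dy^i, d/dv^a, delta^d/delta^d x^i, delta^d/delta^d u^a *)
  let dx (i : 'I_n1) (h : P -> R) := dpos (lat i) h in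
  let du (a : 'I_n2) (h : P -> R) := dpos (grk a) h in
  let dy (i : 'I_n1) (h : P -> R) := dvel (lat i) h in
  let dv (a : 'I_n2) (h : P -> R) := dvel (grk a) h in
  let ddx (i : 'I_n1) (h : P -> R) := hdelta L (lat i) h in
  let ddu (a : 'I_n2) (h : P -> R) := hdelta L (grk a) h in
  (* product objects: RR b a c d = R_b^a_cd, and the mixed components
     GG1 r a = G^r_a and GG2 m k = G^m_k of the nonlinear connection *)
  let RR (b a c d : 'I_(n1 + n2)) : P -> R := riem L b a c d in
  let GG1 (r : 'I_n1) (a : 'I_n2) : P -> R := nonlin L (lat r) (grk a) in
  let GG2 (m : 'I_n2) (k : 'I_n1) : P -> R := nonlin L (grk m) (lat k) in
  (* component objects: g_ij, g^ij, F^k_ij, R_j^i_kl *)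
  let g1 (i j : 'I_n1) : P -> R := fun z => glow L1 i j (phase1 z) in
  let g2 (a b : 'I_n2) : P -> R := fun z => glow L2 a b (phase2 z) in
  let G1 (i j : 'I_n1) : P -> R := fun z => gup L1 i j (phase1 z) in
  let G2 (a b : 'I_n2) : P -> R := fun z => gup L2 a b (phase2 z) in
  let C1 (k i j : 'I_n1) : P -> R := fun z => conn L1 k i j (phase1 z) in
  let C2 (c a b : 'I_n2) : P -> R := fun z => conn L2 c a b (phase2 z) in
  let R1 (j i k l : 'I_n1) : P -> R := fun z => riem L1 j i k l (phase1 z) in
  let R2 (a c b d : 'I_n2) : P -> R := fun z => riem L2 a c b d (phase2 z) in
  (* M^r_i, M^m_a, M^i_jk, M^c_ab *)
  let m1 (r i : 'I_n1) : P -> R := fun z =>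
    (2 * ff2 z)^-1 * (\sum_a du a ff2 z * z.2 0 (grk a)) * (r == i)%:R
    - (4 * ff2 z)^-1 * (\sum_h dy i (G1 r h) z * dx h ff1 z) * FF2 z in
  let m2 (m a : 'I_n2) : P -> R := fun z =>
    (2 * ff1 z)^-1 * (\sum_r dx r ff1 z * z.2 0 (lat r)) * (m == a)%:R
    - (4 * ff1 z)^-1 * (\sum_l dv a (G2 m l) z * du l ff2 z) * FF1 z in
  let T1 (i j k : 'I_n1) : P -> R := fun z =>
    2^-1 * \sum_h G1 i h z *
      \sum_r (m1 r k z * dy r (g1 h j) z + m1 r j z * dy r (g1 h k) z
              - m1 r h z * dy r (g1 j k) z) in
  let T2 (c a b : 'I_n2) : P -> R := fun z =>
    2^-1 * \sum_n G2 c n z *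
      \sum_m (m2 m b z * dv m (g2 n a) z + m2 m a z * dv m (g2 n b) z
              - m2 m n z * dv m (g2 a b) z) in
  forall z : P, slit c1 (phase1 z) -> slit c2 (phase2 z) ->
  (forall i j k l : 'I_n1,
    RR (lat j) (lat i) (lat k) (lat l) z =
    R1 j i k l z - alternate (fun k l : 'I_n1 =>
      \sum_r m1 r l z * dy r (C1 i j k) z
      + ddx l (T1 i j k) z
      + \sum_h C1 i l h z * T1 h j k z
      + \sum_h T1 i l h z * C1 h j k z
      - \sum_h T1 i l h z * T1 h j k z
      + (4 * ff1 z * ff2 z)^-1 * \sum_s \sum_α \sum_γ G1 i s z * G2 α γ z
        * (g1 s l z * du γ ff2 z
           - ff2 z * \sum_r GG1 r γ z * dy r (g1 s l) z)
        * (g1 j k z * du α ff2 z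
           - ff2 z * \sum_h GG1 h α z * dy h (g1 j k) z)) k l)
  /\ (forall (i k l : 'I_n1) (α : 'I_n2),
    RR (grk α) (lat i) (lat k) (lat l) z =
    alternate (fun k l : 'I_n1 =>
      (2 * ff2 z)^-1 * ddx l (fun w =>
        du α ff2 w * (i == k)%:R
        - ff2 w * \sum_r \sum_h GG1 r α w * G1 i h w * dy r (g1 h k) w) z
      + (2 * ff2 z)^-1 * \sum_r (C1 i r l z - T1 i r l z)
        * (du α ff2 z * (r == k)%:R
           - ff2 z * \sum_m \sum_h GG1 m α z * G1 r h z * dy m (g1 h k) z)
      + (4 * ff1 z * ff2 z)^-1 * \sum_β
        (du β ff2 z * (i == l)%:R
         - ff2 z * \sum_r \sum_h GG1 r β z * G1 i h z * dy r (g1 h l) z)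
        * (dx k ff1 z * (β == α)%:R
           - ff1 z * \sum_μ \sum_κ GG2 μ k z * G2 β κ z * dv μ (g2 α κ) z))
      k l)
  /\ (forall (i j : 'I_n1) (β ρ : 'I_n2),
    RR (lat j) (lat i) (grk β) (grk ρ) z =
    alternate (fun β ρ : 'I_n2 =>
      ddu ρ (fun w => (2 * ff2 w)^-1 *
        (du β ff2 w * (i == j)%:R
         - ff2 w * \sum_r \sum_h GG1 r β w * G1 i h w * dy r (g1 h j) w)) z
      + (4 * ff2 z ^+ 2)^-1 * \sum_r
        (du ρ ff2 z * (i == r)%:R
         - ff2 z * \sum_m \sum_h GG1 m ρ z * G1 i h z * dy m (g1 h r) z)
        * (du β ff2 z * (r == j)%:R
           - ff2 z * \sum_l \sum_s GG1 l β z * G1 r s z * dy l (g1 s j) z)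
      - (4 * ff1 z * ff2 z)^-1 * \sum_α
        ((\sum_h dx h ff1 z * G1 i h z * g2 α ρ z)
         - ff1 z * \sum_μ \sum_h GG2 μ h z * G1 i h z * dv μ (g2 α ρ) z)
        * (dx j ff1 z * (α == β)%:R
           - ff1 z * \sum_ν \sum_γ GG2 ν j z * G2 α γ z * dv ν (g2 β γ) z))
      β ρ)
  /\ (forall (i l : 'I_n1) (α β : 'I_n2),
    RR (grk α) (lat i) (grk β) (lat l) z =
      - ddu β (fun w => (2 * ff2 w)^-1 *
          (du α ff2 w * (i == l)%:R
           - ff2 w * \sum_r \sum_h GG1 r α w * G1 i h w * dy r (g1 h l) w)) z
      - (2 * ff2 z)^-1 * ddx l (fun w =>
          (\sum_h dx h ff1 w * G1 i h w * g2 α β w)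
          - ff1 w * \sum_κ \sum_h GG2 κ h w * G1 i h w * dv κ (g2 α β) w) z
      - (4 * ff2 z ^+ 2)^-1 * (\sum_r
          (du β ff2 z * (i == r)%:R
           - ff2 z * \sum_m \sum_h GG1 m β z * G1 i h z * dy m (g1 h r) z)
          * (du α ff2 z * (r == l)%:R
             - ff2 z * \sum_s \sum_n GG1 s α z * G1 r n z * dy s (g1 n l) z))
      + (4 * ff1 z * ff2 z)^-1 * (\sum_μ
          ((\sum_h dx h ff1 z * G1 i h z * g2 μ β z)
           - ff1 z * \sum_κ \sum_h GG2 κ h z * G1 i h z * dv κ (g2 μ β) z)
          * (dx l ff1 z * (μ == α)%:R
             - ff1 z * \sum_ν \sum_γ GG2 ν l z * G2 μ γ z * dv ν (g2 γ α) z))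
      - (2 * ff2 z)^-1 * (\sum_r \sum_h G1 r h z
          * (C1 i r l z - T1 i r l z)
          * (dx h ff1 z * g2 α β z
             - ff1 z * \sum_κ GG2 κ h z * dv κ (g2 α β) z))
      + (2 * ff2 z)^-1 * (\sum_μ
          (du μ ff2 z * (i == l)%:R
           - ff2 z * \sum_r \sum_h GG1 r μ z * G1 i h z * dy r (g1 h l) z)
          * (C2 μ α β z - T2 μ α β z)))
  /\ (forall (j : 'I_n1) (γ β ρ : 'I_n2),
    RR (lat j) (grk γ) (grk β) (grk ρ) z =
    alternate (fun β ρ : 'I_n2 =>
      (2 * ff1 z)^-1 * ddu ρ (fun w =>
        dx j ff1 w * (γ == β)%:R
        - ff1 w * \sum_α \sum_μ GG2 α j w * G2 γ μ w * dv α (g2 β μ) w) z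
      + (2 * ff1 z)^-1 * \sum_α (C2 γ α ρ z - T2 γ α ρ z)
        * (dx j ff1 z * (α == β)%:R
           - ff1 z * \sum_ν \sum_μ GG2 ν j z * G2 α μ z * dv ν (g2 β μ) z)
      + (4 * ff1 z * ff2 z)^-1 * \sum_r
        (dx r ff1 z * (γ == ρ)%:R
         - ff1 z * \sum_α \sum_μ GG2 α r z * G2 γ μ z * dv α (g2 ρ μ) z)
        * (du β ff2 z * (r == j)%:R
           - ff2 z * \sum_m \sum_h GG1 m β z * G1 r h z * dy m (g1 h j) z))
      β ρ)
  /\ (forall (k l : 'I_n1) (γ α : 'I_n2),
    RR (grk α) (grk γ) (lat k) (lat l) z =
    alternate (fun k l : 'I_n1 =>
      ddx l (fun w => (2 * ff1 w)^-1 *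
        (dx k ff1 w * (γ == α)%:R
         - ff1 w * \sum_μ \sum_ρ GG2 μ k w * G2 γ ρ w * dv μ (g2 α ρ) w)) z
      + (4 * ff1 z ^+ 2)^-1 * \sum_β
        (dx l ff1 z * (γ == β)%:R
         - ff1 z * \sum_κ \sum_ρ GG2 κ l z * G2 γ ρ z * dv κ (g2 β ρ) z)
        * (dx k ff1 z * (β == α)%:R
           - ff1 z * \sum_ν \sum_μ GG2 ν k z * G2 β μ z * dv ν (g2 α μ) z)
      - (4 * ff1 z * ff2 z)^-1 * \sum_ρ \sum_r G2 γ ρ z
        * (du ρ ff2 z * g1 l r z
           - ff2 z * \sum_m GG1 m ρ z * dy m (g1 l r) z)
        * (du α ff2 z * (r == k)%:R
           - ff2 z * \sum_s \sum_h GG1 s α z * G1 r h z * dy s (g1 h k) z))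
      k l)
  /\ (forall α γ β ρ : 'I_n2,
    RR (grk α) (grk γ) (grk β) (grk ρ) z =
    R2 α γ β ρ z - alternate (fun β ρ : 'I_n2 =>
      \sum_κ m2 κ ρ z * dv κ (C2 γ α β) z
      + ddu ρ (T2 γ α β) z
      + \sum_μ C2 γ ρ μ z * T2 μ α β z
      + \sum_μ T2 γ ρ μ z * (C2 μ α β z - T2 μ α β z)
      + (4 * ff1 z * ff2 z)^-1 * \sum_ν \sum_r \sum_s G2 γ ν z * G1 r s z
        * (g2 ν ρ z * dx s ff1 z
           - ff1 z * \sum_κ GG2 κ s z * dv κ (g2 ν ρ) z)
        * (g2 α β z * dx r ff1 z
           - ff1 z * \sum_μ GG2 μ r z * dv μ (g2 α β) z)) β ρ).
Proof.
cbv beta zeta.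
(* Block extraction and reindexing are the same projections; rewriting them as functions also
   reaches the occurrences under binders. *)
have E1 : @phase1 R n1 n2 = subphase (@lshift n1 n2).
  by apply/funext => z; congr (_, _); apply/rowP => j; rewrite !mxE.
have E2 : @phase2 R n1 n2 = subphase (@rshift n1 n2).
  by apply/funext => z; congr (_, _); apply/rowP => j; rewrite !mxE.
rewrite E1 E2 {E1 E2} => z A1z A2z.
have D := doubly_warped_finsler F1 F2 f1_smooth f2_smooth f1_gt0 f2_gt0 c1_atlas c2_atlas.
have D' := doubly_warped_sym D.
have Az := conj A1z A2z; have Az' := conj A2z A1z.
split=> [i j k l|].
  rewrite (riem1111 D _ _ _ _ Az); congr (_ - _); apply: eq_alternate => {}k {}l.
  congr (_ + _ * _); apply: eq_bigr => s _; apply: eq_bigr => a _; apply: eq_bigr => c _.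
  by rewrite !(mixed_dglowE D _ _ _ Az).
(* Here, as for the third and fifth components, both sides then agree by unfolding the mixed
   brackets. *)
split=> [i k l a|]; first by rewrite (riem2111 D _ _ _ _ Az).
split=> [i j b c|]; first by rewrite (riem1122 D _ _ _ _ Az).
split=> [i l a b|].
  (* Only the fifth term differs in form: the statement has g^{rh} outside the bracket, so
     [mixed_conn22] is expanded as a contraction. *)
  rewrite (riem2121 D _ _ _ _ Az); congr (_ - _ * _ + _); apply: eq_bigr => r _.
  rewrite (mixed_conn22E D _ _ _ Az) mulr_sumr; apply: eq_bigr => h _.
  rewrite (mixed_dglowE D' _ _ _ Az').
  have E (g c d p q : R) : c * (g * (p * q - d)) = g * c * (q * p - d) by ring.
  exact: E.
split=> [j c a b|]; first by rewrite (riem1222 D _ _ _ _ Az).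
split=> [k l c a|a c b r].
  rewrite (riem2211 D _ _ _ _ Az); apply: eq_alternate => {}k {}l.
  congr (_ - _ * _); apply: eq_bigr => m _; apply: eq_bigr => r _.
  rewrite (mixed_dglowE D _ _ _ Az).
  have E (g d p q x : R) : g * (p * q - d) * x = g * (q * p - d) * x by ring.
  exact: E.
rewrite (riem2222 D _ _ _ _ Az); congr (_ - _); apply: eq_alternate => {}b {}r.
congr (_ + _ * _); apply: eq_bigr => n _; apply: eq_bigr => i _; apply: eq_bigr => j _.
by rewrite !(mixed_dglowE D' _ _ _ Az').
Qed.
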